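(* There exist positive universal constants $C_1,C_2$ such that for any $n\ge1$, for any continuously differentiable function $f:\mathbb{R}^n\to[-1,1]$, and for any $\rho\in(0,1)$, $$\mathrm{VAR}^{\mathcal G}(f,\rho)\ \le\ C_1\cdot\Big(\sum_{i=1}^n\mathbb{E}_\mu[|\partial_i f|]^2\Big)^{C_2\rho^2}.$$
   Context: $\mu$ is the standard Gaussian measure on $\mathbb{R}$ and $\mathbb{E}_\mu$ denotes integration with respect to the product measure $\mu^{\otimes n}$ on $\mathbb{R}^n$. (If some $\mathbb{E}_\mu[|\partial_i f|]=\infty$, the right-hand side is $+\infty$.) Let $W,W'$ be i.i.d. standard Gaussian vectors on $\mathbb{R}^n$ and $W^\rho=\sqrt{1-\rho^2}\,W+\rho W'$. For $f:\mathbb{R}^n\to\mathbb{R}$ with $\mathbb{E}[|f(W)|^2]<\infty$, $Z^{\mathcal G}(f,\rho)=\mathbb{E}[f(W)f(W^\rho)]$ and $\mathrm{VAR}^{\mathcal G}(f,\rho)=Z^{\mathcal G}(f,\rho)-\mathbb{E}[f(W)]^2$. *)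

(* Defs.v *)
From HB Require Import structures.
From mathcomp Require Import all_boot all_order all_algebra.
From mathcomp Require Import all_classical all_reals all_analysis.

Set Implicit Arguments.
Unset Strict Implicit.
Unset Printing Implicit Defensive.

Import Order.TTheory GRing.Theory Num.Theory.
Import numFieldNormedType.Exports.

Local Open Scope classical_set_scope.
Local Open Scope ring_scope.

Section gaussian_measure.
Variable R : realType.

Local Notation borelR := (measurableTypeR R).

Definition pair_cons (n : nat) (p : borelR * n.-tuple borelR) :
  n.+1.-tuple borelR := [the n.+1.-tuple borelR of p.1 :: p.2].

Lemma measurable_pair_cons (n : nat) :
  measurable_fun [set: borelR * n.-tuple borelR] (@pair_cons n).
Proof. exact: measurable_cons. Qed.

HB.instance Definition _ (n : nat) :=
  isMeasurableFun.Build _ _ _ _ (@pair_cons n) (@measurable_pair_cons n).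

(* The n-fold product of the standard Gaussian measure. It lives on tuples
   because the library has a product sigma-algebra on tuples but none on
   row vectors; [gaussian_box] evaluates it on boxes. *)
Fixpoint gaussian (n : nat) : probability (n.-tuple borelR) R :=
  match n with
  | 0 => \d_([tuple] : 0.-tuple borelR)
  | m.+1 => distribution (normal_prob (0 : R) 1 \x gaussian m)%E (@pair_cons m)
  end.

Lemma gaussian_box (n : nat) (A : 'I_n -> set borelR) :
  (forall i, measurable (A i)) ->
  gaussian n [set t | forall i, A i (tnth t i)] =
  (\prod_(i < n) normal_prob (0 : R) 1 (A i))%E.
Proof.
elim: n A => [|n IHn] A mA.
  rewrite big_ord0 /= diracE (_ : _ \in _) //.
  by rewrite inE => -[].
rewrite big_ord_recl /= -IHn; last by move=> i; exact: mA.
rewrite /distribution /pushforward.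
rewrite (_ : _ @^-1` _ =
    A ord0 `*` [set t | forall i, A (lift ord0 i) (tnth t i)]).
  apply: product_measure1E => //.
  rewrite (_ : [set t | _] = \bigcap_(i in [set: 'I_n])
      (fun t : n.-tuple borelR => tnth t i) @^-1` A (lift ord0 i)).
    apply: fin_bigcap_measurable => [|i _]; first exact: finite_finset.
    rewrite -[_ @^-1` _]setTI.
    exact: measurable_tnth (mA (lift ord0 i)).
  by apply/seteqP;
    split=> t tA i; [move=> _; exact: tA i|exact: tA i I].
apply/seteqP; split=> -[x t] /= => [tA|[xA tA] i].
  split=> [|i]; first exact: tA ord0.
  by have := tA (lift ord0 i); rewrite tnthS.
by case: (unliftP ord0 i) => [j|] -> //; rewrite tnthS.
Qed.

End gaussian_measure.

Section gaussian_stability.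
Variables (R : realType) (n : nat).

Local Notation tupR := (n.-tuple (measurableTypeR R)).

Definition vec (t : tupR) : 'rV[R]_n := \row_i tnth t i.

Definition gaussian_mean (g : 'rV[R]_n -> R) : \bar R :=
  ('E_(gaussian R n)[fun w => g (vec w)])%E.

Definition partial (f : 'rV[R]_n -> R) (i : 'I_n) (x : 'rV[R]_n) : R :=
  'D_(delta_mx 0 i) f x.

Definition continuously_differentiable (f : 'rV[R]_n -> R) : Prop :=
  (forall x, differentiable f x) /\ (forall i, continuous (partial f i)).

(* Under [gaussian R n \x gaussian R n] the two projections of a pair are
   independent standard Gaussian vectors: they are W and W'. *)
Definition Z_gauss (f : 'rV[R]_n -> R) (rho : R) : \bar R :=
  ('E_(gaussian R n \x gaussian R n)[fun w : tupR * tupR =>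
     (f (vec w.1) *
      f (Num.sqrt (1 - rho ^+ 2) *: vec w.1 + rho *: vec w.2))%R])%E.

(* Both terms are finite when f is square integrable, so the extended-real
   subtraction is the ordinary one. *)
Definition VAR_gauss (f : 'rV[R]_n -> R) (rho : R) : \bar R :=
  (Z_gauss f rho - gaussian_mean f ^+ 2)%E.

End gaussian_stability.

(* Main.v *)
Require Import Defs.
From HB Require Import structures.
From mathcomp Require Import all_boot all_order all_algebra.
From mathcomp Require Import all_classical all_reals all_analysis.
From mathcomp Require Import measurable_realfun charge ring lra.

Set Implicit Arguments.
Unset Strict Implicit.
Unset Printing Implicit Defensive.

Import Order.TTheory GRing.Theory Num.Theory.
Import numFieldNormedType.Exports.

Local Open Scope classical_set_scope.
Local Open Scope ring_scope.

(** Let X and Y be standard Gaussian vectors with correlation q in each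
    coordinate, and V(q) the covariance of f(X) and f(Y), called [noise_cov].
    The left-hand side of the theorem is V(q) for q = sqrt (1 - rho^2). Let S
    be the sum of the squares of the L1 influences [influence1], that is of
    E|f(X) - f(X')| where X' is X with one coordinate resampled. An L1 Poincare
    inequality on the line bounds each influence by a constant times the mean of
    |d_i f| ([influence1_le]), so it is enough to bound V(q) by a power of S,
    for any measurable f with values in [-1, 1].

    Small correlation. If q <= 1/10 then V(q)^4 <= S ([noise_cov_small]). Let
    d_i = E[f | X_i, ..., X_n] - E[f | X_(i+1), ..., X_n] be the martingale
    differences of f. The noise operator P_q, which averages f over Y for given
    X, keeps them orthogonal, so V(q) is the sum of E[d_i P_q d_i]. As P_q is a
    contraction from L2 to L4 for such q ([mix_hypercontractive]), each term is
    at most ||d_i||_1^(1/2) ||d_i||_2^(3/2). Here ||d_i||_1 is at most the i-th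
    influence, and the ||d_i||_2^2 add up to Var f <= 1: this is why martingale
    differences are used, as the functions f - E[f | X_j, j <> i] satisfy no such
    dimension-free bound. Hoelder's inequality concludes ([noise_cov_le]).

    The contraction property must hold with constant one, otherwise it would not
    tensorize over the coordinates; but any fixed q > 0 will do. This makes an
    elementary proof on the line possible ([ou_hypercontractive]): for q small
    the Mehler kernel is so close to 1 that P_q is very small on centred
    functions, in a sense which explicit Gaussian integrals measure.

    All correlations. Since P_q is self-adjoint and P_q P_q = P_(q^2), the
    Cauchy-Schwarz inequality gives V(q)^2 <= V(q^2) ([noise_cov_sqr_le]). After
    k steps the correlation q^(2^k) is at most 1/10, and 2^k <= 36 / rho^2
    suffices. Hence V(q)^(4 N) <= S for some N <= 36 / rho^2
    ([noise_cov_pow]), and taking roots gives the exponent rho^2 / 144. *)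

(** * Bounded measurable functions *)

Section bounded_measurable.
Context {R : realType}.

(** This class is stable under products and under integrating out a variable
    against a probability, so that linearity, monotonicity and Fubini hold
    without integrability conditions. *)
Definition bmfun d (T : measurableType d) (f : T -> R) : Prop :=
  measurable_fun [set: T] f /\ exists M : R, forall x, `|f x| <= M.

Section closure.
Context d (T : measurableType d).
Implicit Types f g : T -> R.

Lemma bm_cst (r : R) : bmfun (fun _ : T => r).
Proof. by split; [exact: measurable_cst|exists `|r|]. Qed.

Lemma bmD f g : bmfun f -> bmfun g -> bmfun (fun x => f x + g x).
Proof.
move=> [mf [M hM]] [mg [N hN]]; split; first exact: measurable_funD.
by exists (M + N) => x; rewrite (le_trans (ler_normD _ _))// lerD.
Qed.

Lemma bmN f : bmfun f -> bmfun (fun x => - f x).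
Proof.
move=> [mf [M hM]]; split; last by exists M => x; rewrite normrN.
exact: measurableT_comp.
Qed.

Lemma bmB f g : bmfun f -> bmfun g -> bmfun (fun x => f x - g x).
Proof. by move=> hf hg; apply: bmD => //; exact: bmN. Qed.

Lemma bmM f g : bmfun f -> bmfun g -> bmfun (fun x => f x * g x).
Proof.
move=> [mf [M hM]] [mg [N hN]]; split; first exact: measurable_funM.
by exists (M * N) => x; rewrite normrM ler_pM.
Qed.

Lemma bmX f n : bmfun f -> bmfun (fun x => f x ^+ n).
Proof.
move=> hf; elim: n => [|n ih]; first exact: bm_cst.
rewrite (_ : (fun _ => _) = fun x => f x * f x ^+ n); first exact: bmM.
by apply/funext => x; rewrite exprS.
Qed.

Lemma bm_norm f : bmfun f -> bmfun (fun x => `|f x|).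
Proof.
move=> [mf [M hM]]; split; last by exists M => x; rewrite normr_id.
exact: measurableT_comp.
Qed.

Lemma bm_comp d' (T' : measurableType d') (f : T -> R) (phi : T' -> T) :
  bmfun f -> measurable_fun [set: T'] phi -> bmfun (fun x => f (phi x)).
Proof.
move=> [mf [M hM]] mphi; split; last by exists M.
exact: measurableT_comp.
Qed.

End closure.

Lemma bm_comp2 d1 d2 d (T1 : measurableType d1) (T2 : measurableType d2)
    (T : measurableType d) (F : T1 -> T2 -> R) (a : T -> T1) (b : T -> T2) :
  bmfun (fun p : T1 * T2 => F p.1 p.2) ->
  measurable_fun [set: T] a -> measurable_fun [set: T] b ->
  bmfun (fun x => F (a x) (b x)).
Proof.
move=> hF ma mb; apply: (bm_comp (phi := fun x => (a x, b x)) hF).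
exact/measurable_fun_pairP.
Qed.

Section integral.
Context d (T : measurableType d) (P : probability T R).
Implicit Types f g : T -> R.

Lemma bm_integrable f : bmfun f -> P.-integrable [set: T] (EFin \o f).
Proof.
move=> [mf [M hM]]; apply: (@le_integrable _ _ _ _ _ measurableT _ (cst M%:E)).
- exact/measurable_EFinP.
- move=> x _ /=; rewrite lee_fin (le_trans (hM x))//.
  exact: ler_norm.
- exact: finite_measure_integrable_cst.
Qed.

Lemma bm_EFin f : bmfun f ->
  (\int[P]_x (f x)%:E)%E = (\int[P]_x f x)%:E.
Proof.
move=> hf; rewrite /Rintegral fineK//.
exact: integrable_fin_num (bm_integrable hf).
Qed.

Lemma EP_cst (r : R) : \int[P]_x r = r.
Proof. by rewrite Rintegral_cst//= probability_setT mulr1. Qed.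

Lemma EPD f g : bmfun f -> bmfun g ->
  \int[P]_x (f x + g x) = \int[P]_x f x + \int[P]_x g x.
Proof. by move=> hf hg; rewrite RintegralD//; exact: bm_integrable. Qed.

Lemma EPB f g : bmfun f -> bmfun g ->
  \int[P]_x (f x - g x) = \int[P]_x f x - \int[P]_x g x.
Proof. by move=> hf hg; rewrite RintegralB//; exact: bm_integrable. Qed.

Lemma EPZl (r : R) f : bmfun f -> \int[P]_x (r * f x) = r * \int[P]_x f x.
Proof. by move=> hf; rewrite RintegralZl//; exact: bm_integrable. Qed.

Lemma EPZr (r : R) f : bmfun f -> \int[P]_x (f x * r) = \int[P]_x f x * r.
Proof. by move=> hf; rewrite RintegralZr//; exact: bm_integrable. Qed.

Lemma EP_le f g : bmfun f -> bmfun g -> (forall x, f x <= g x) ->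
  \int[P]_x f x <= \int[P]_x g x.
Proof. by move=> hf hg fg; rewrite le_Rintegral//; exact: bm_integrable. Qed.

Lemma EP_ge0 f : (forall x, 0 <= f x) -> 0 <= \int[P]_x f x.
Proof. by move=> f0; apply: Rintegral_ge0. Qed.

Lemma EP_norm f : bmfun f -> `|\int[P]_x f x| <= \int[P]_x `|f x|.
Proof. by move=> hf; apply: le_normr_Rintegral => //; exact: bm_integrable. Qed.

Lemma EP_bound f M : bmfun f -> (forall x, `|f x| <= M) -> `|\int[P]_x f x| <= M.
Proof.
move=> hf hM; apply: le_trans (EP_norm hf) _; rewrite -[leRHS](EP_cst M).
by apply: EP_le => //; [exact: bm_norm|exact: bm_cst].
Qed.

Lemma eq_EP f g : f =1 g -> \int[P]_x f x = \int[P]_x g x.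
Proof. by move=> fg; apply: eq_Rintegral => x _. Qed.

(** The quadratic form [s, t |-> E[w (s f - t g)^2]] is nonnegative, so its
    discriminant is not positive. *)
Lemma weighted_cauchy_schwarz w f g : bmfun w -> (forall x, 0 <= w x) ->
  bmfun f -> bmfun g ->
  (\int[P]_x (w x * (f x * g x))) ^+ 2 <=
  (\int[P]_x (w x * f x ^+ 2)) * (\int[P]_x (w x * g x ^+ 2)).
Proof.
move=> hw w0 hf hg.
have hff : bmfun (fun x => w x * f x ^+ 2) by apply: bmM => //; exact: bmX.
have hgg : bmfun (fun x => w x * g x ^+ 2) by apply: bmM => //; exact: bmX.
have hfg : bmfun (fun x => w x * (f x * g x)) by apply: bmM => //; exact: bmM.
set a := \int[P]_x (w x * f x ^+ 2); set b := \int[P]_x (w x * g x ^+ 2).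
set c := \int[P]_x (w x * (f x * g x)).
have Q (s t : R) : 0 <= s ^+ 2 * a - (2 * s * t) * c + t ^+ 2 * b.
  have -> : s ^+ 2 * a - (2 * s * t) * c + t ^+ 2 * b =
      \int[P]_x (w x * (s * f x - t * g x) ^+ 2).
    rewrite /a /b /c -!EPZl// -EPB; [|by apply: bmM => //; exact: bm_cst..].
    rewrite -EPD; [|apply: bmB|]; try by apply: bmM => //; exact: bm_cst.
    by apply: eq_EP => x; ring.
  by apply: EP_ge0 => x; rewrite mulr_ge0// sqr_ge0.
have a0 : 0 <= a by have := Q 1 0; lra.
have b0 : 0 <= b by have := Q 0 1; lra.
have [b_gt0|] := ltP 0 b.
  have := Q b c; have -> : b ^+ 2 * a - 2 * b * c * c + c ^+ 2 * b =
    b * (a * b - c ^+ 2) by ring.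
  by rewrite pmulr_rge0// subr_ge0.
move=> b_le0; have b00 : b = 0 by apply/eqP; rewrite eq_le b_le0.
rewrite b00 mulr0.
have [->|c0] := eqVneq c 0; first by rewrite expr0n.
(* With [b = 0] the form is affine in [t], and this [t] would give it the
   value [-1]. *)
have := Q 1 ((a + 1) / (2 * c)).
have -> : 2 * 1 * ((a + 1) / (2 * c)) * c = a + 1 by field.
by rewrite b00; lra.
Qed.

Lemma cauchy_schwarz f g : bmfun f -> bmfun g ->
  (\int[P]_x (f x * g x)) ^+ 2 <= (\int[P]_x (f x ^+ 2)) * (\int[P]_x (g x ^+ 2)).
Proof.
move=> hf hg; have := weighted_cauchy_schwarz (bm_cst T 1) (fun _ => ler01) hf hg.
have E1 (h : T -> R) : \int[P]_x (1 * h x) = \int[P]_x h x.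
  by apply: eq_EP => x; rewrite mul1r.
by rewrite (E1 (fun x => f x * g x)) !E1.
Qed.

Lemma jensen_sqr f : bmfun f -> (\int[P]_x f x) ^+ 2 <= \int[P]_x (f x ^+ 2).
Proof.
move=> hf; have := cauchy_schwarz hf (bm_cst T 1).
rewrite (@eq_EP (fun x => f x * 1) f); last by move=> x; rewrite mulr1.
by rewrite expr1n EP_cst mulr1.
Qed.

End integral.

Section fubini.
Context d1 d2 (T1 : measurableType d1) (T2 : measurableType d2).
Variable F : T1 -> T2 -> R.
Hypothesis hF : bmfun (fun p : T1 * T2 => F p.1 p.2).

Lemma bm_section1 x : bmfun (F x).
Proof. exact: (bm_comp2 hF). Qed.

Lemma bm_section2 y : bmfun (F ^~ y).
Proof. exact: (bm_comp2 hF). Qed.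

Lemma bm_int (P2 : probability T2 R) : bmfun (fun x => \int[P2]_y F x y).
Proof.
have [_ [M hM]] := hF; split; last first.
  by exists M => x; apply: EP_bound => [|y]; [exact: bm_section1|exact: (hM (x, y))].
(* Tonelli's measurability statement is about nonnegative integrands. *)
have hFM : bmfun (fun p : T1 * T2 => F p.1 p.2 + M) by apply: bmD => //; exact: bm_cst.
rewrite (_ : (fun _ => _) = fun x => fine (\int[P2]_y (F x y + M)%:E)%E - M).
  apply: measurable_funB; last exact: measurable_cst.
  apply: measurableT_comp => //.
  apply: (measurable_fun_fubini_tonelli_F (fun p => (F p.1 p.2 + M)%:E)).
    by apply/measurable_EFinP; exact: hFM.1.
  by move=> p; rewrite lee_fin; have := hM p; rewrite ler_norml; lra.
apply/funext => x; rewrite -/(\int[P2]_y (F x y + M)) EPD ?EP_cst; first by ring.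
  exact: bm_section1.
exact: bm_cst.
Qed.

End fubini.

Section fubini2.
Context d1 d2 (T1 : measurableType d1) (T2 : measurableType d2).
Variable F : T1 -> T2 -> R.
Hypothesis hF : bmfun (fun p : T1 * T2 => F p.1 p.2).
Variables (P1 : probability T1 R) (P2 : probability T2 R).

Lemma EP_pair :
  \int[(P1 \x P2)%E]_p F p.1 p.2 = \int[P1]_x \int[P2]_y F x y.
Proof.
apply: EFin_inj; rewrite -(bm_EFin _ hF) -(bm_EFin P1 (bm_int hF P2)).
have := integral12_prod_meas1 (@bm_integrable _ _ (P1 \x P2)%E _ hF).
move=> /= <-; apply: eq_integral => x _.
by rewrite -bm_EFin//; exact: bm_section1.
Qed.

Lemma EP_fubini :
  \int[P1]_x \int[P2]_y F x y = \int[P2]_y \int[P1]_x F x y.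
Proof.
have hF' : bmfun (fun p : T2 * T1 => F p.2 p.1) by exact: (bm_comp2 hF).
apply: EFin_inj; rewrite -(bm_EFin P1 (bm_int hF P2)) -(bm_EFin P2 (bm_int hF' P1)).
have := Fubini (@bm_integrable _ _ (P1 \x P2)%E _ hF).
rewrite /= => H; transitivity (\int[P1]_x \int[P2]_y (F x y)%:E)%E.
  by apply: eq_integral => x _; rewrite -bm_EFin//; exact: bm_section1.
rewrite H; apply: eq_integral => x _.
by rewrite -bm_EFin//; exact: bm_section2.
Qed.

End fubini2.

End bounded_measurable.

(** * Integrals against the standard Gaussian *)

Section gauss1.
Context {R : realType}.
Local Notation leb := (@lebesgue_measure R).
Local Notation borelR := (measurableTypeR R).
Local Notation G := (normal_prob (0 : R) 1).

(** Uniqueness of densities identifies the Radon-Nikodym derivative of the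
    Gaussian with [normal_pdf 0 1] almost everywhere. *)
Lemma integral_normal_prob (f : borelR -> \bar R) :
  measurable_fun [set: borelR] f -> (forall x, 0 <= f x)%E ->
  (\int[G]_x f x = \int[leb]_x (f x * (normal_pdf 0 1 x)%:E))%E.
Proof.
move=> mf f0.
have dom := @normal_prob_dominates R 0 1.
rewrite -(Radon_Nikodym_SigmaFinite.change_of_variables dom)//.
have mRN := measurable_int _ (Radon_Nikodym_SigmaFinite.f_integrable dom).
have mpdf : measurable_fun [set: borelR] (fun x => (normal_pdf (0 : R) 1 x)%:E).
  by apply/measurable_EFinP; exact: measurable_normal_pdf.
apply: ge0_ae_eq_integral => //.
- exact: emeasurable_funM.
- exact: emeasurable_funM.
- by move=> x _; rewrite mule_ge0// Radon_Nikodym_SigmaFinite.f_ge0.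
- by move=> x _; rewrite mule_ge0// lee_fin normal_pdf_ge0.
- apply: ae_eqe_mul2l => /=; apply: integral_ae_eq => //=.
    exact: Radon_Nikodym_SigmaFinite.f_integrable.
  by move=> E _ mE; rewrite -Radon_Nikodym_SigmaFinite.f_integral.
Qed.

Let affine (b c : R) (z : borelR) : borelR := b + c * z.

Let maffine b c : measurable_fun [set: borelR] (affine b c).
Proof. by apply: measurable_funD => //; apply: measurable_funM. Qed.

(** The image of [c] times Lebesgue measure under [z |-> b + c z] agrees with
    Lebesgue measure on intervals. *)
Lemma ge0_integral_affine (b c : R) (f : borelR -> \bar R) : 0 < c ->
  measurable_fun [set: borelR] f -> (forall x, 0 <= f x)%E ->
  (\int[leb]_y f y = c%:E * \int[leb]_z f (b + c * z)%R)%E.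
Proof.
move=> c0 mf f0.
pose nu := mscale (NngNum (ltW c0)) (pushforward leb (affine b c)).
have E A : measurable A -> leb A = nu (maffine b c) A.
  apply: lebesgue_measure_unique => _ [[u v]] _ <- /=.
  rewrite /nu /mscale/= /pushforward.
  rewrite (_ : _ @^-1` _ = `](u - b) / c, (v - b) / c]%classic); last first.
    apply/seteqP; split => z /=; rewrite !in_itv/= /affine ltr_pdivrMr// ler_pdivlMr//;
    by rewrite (mulrC z) ltrBlDl lerBrDl.
  rewrite !lebesgue_measure_itv/= !lte_fin.
  rewrite ltr_pM2r ?invr_gt0// ltrD2r; case: ifPn => _; last by rewrite mule0.
  by rewrite -!EFinB -EFinM; congr EFin; field; rewrite gt_eqF.
rewrite (eq_measure_integral (nu (maffine b c))); last by move=> A mA _; exact: E.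
rewrite ge0_integral_mscale//=; congr (_ * _)%E.
by rewrite ge0_integral_pushforward.
Qed.

(** Completing the square: up to a constant factor, the integrand times the
    Gaussian density is the density of mean [b s^2] and standard deviation
    [s = (1 - 2 u)^(-1/2)]. *)
Lemma gauss_integral_quad (u b : R) : u < 2^-1 ->
  (\int[G]_y (expR (u * y ^+ 2 + b * y))%:E =
   ((Num.sqrt (1 - 2 * u))^-1 * expR (b ^+ 2 / (2 * (1 - 2 * u))))%:E)%E.
Proof.
move=> u2; have a0 : 0 < 1 - 2 * u by lra.
have s0 : 0 < Num.sqrt (1 - 2 * u) by rewrite sqrtr_gt0.
set s := (Num.sqrt (1 - 2 * u))^-1.
have s_gt0 : 0 < s by rewrite invr_gt0.
have s2 : s ^+ 2 = (1 - 2 * u)^-1 by rewrite exprVn sqr_sqrtr// ltW.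
have mE : measurable_fun [set: borelR] (fun y : R => expR (u * y ^+ 2 + b * y)).
  apply: measurableT_comp => //; apply: measurable_funD; apply: measurable_funM => //.
rewrite integral_normal_prob; last 2 first.
  exact/measurable_EFinP.
  by move=> x; rewrite lee_fin expR_ge0.
transitivity (\int[leb]_y ((s * expR (b ^+ 2 / (2 * (1 - 2 * u))))%:E *
    (normal_pdf (b * s ^+ 2) s y)%:E))%E; last first.
  rewrite integralZl//; last exact: integrable_normal_pdf.
  by rewrite integral_normal_pdf mule1.
apply: eq_integral => y _; rewrite -!EFinM; congr EFin.
rewrite !normal_pdfE ?gt_eqF// /normal_peak /normal_fun.
rewrite expr1n mul1r -(mulr_natr (s ^+ 2 * pi)) -mulrA sqrtrM ?sqr_ge0//.
rewrite sqrtr_sqr gtr0_norm// -(mulr_natr pi).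
set p := Num.sqrt _; have p0 : p != 0.
  by rewrite gt_eqF// sqrtr_gt0 mulr_gt0 ?pi_gt0.
rewrite mulrCA -expRD.
rewrite [RHS](_ : _ = p^-1 * (expR (b ^+ 2 / (2 * (1 - 2 * u))) *
  expR (- (y - b * s ^+ 2) ^+ 2 / (s ^+ 2 *+ 2)))); last first.
  by field; rewrite p0 gt_eqF.
rewrite -expRD; congr (_ * expR _).
rewrite s2; field; lra.
Qed.

End gauss1.

(** * The Mehler kernel *)

Section mehler.
Context {R : realType}.
Local Notation leb := (@lebesgue_measure R).
Local Notation borelR := (measurableTypeR R).
Local Notation G := (normal_prob (0 : R) 1).

(** The density of [q x + sqrt (1 - q^2) Z], with [Z] standard Gaussian,
    relative to the standard Gaussian measure ([ge0_ou_mehler]). *)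
Definition mehler (q x y : R) : R :=
  (Num.sqrt (1 - q ^+ 2))^-1 *
  expR ((2 * q * x * y - q ^+ 2 * (x ^+ 2 + y ^+ 2)) / (2 * (1 - q ^+ 2))).

Lemma mehler_ge0 q x y : 0 <= mehler q x y.
Proof. by rewrite /mehler mulr_ge0 ?expR_ge0// invr_ge0 sqrtr_ge0. Qed.

Lemma mehlerC q x y : mehler q x y = mehler q y x.
Proof. by rewrite /mehler (mulrAC _ x y) (addrC (x ^+ 2)). Qed.

Lemma measurable_mehler q :
  measurable_fun [set: borelR * borelR] (fun p => mehler q p.1 p.2).
Proof.
apply: measurable_funM => //; apply: measurableT_comp => //.
apply: measurable_funM => //; apply: measurable_funB.
  by apply: measurable_funM => //; apply: measurable_funM.
apply: measurable_funM => //.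
by apply: measurable_funD; exact: measurable_funX.
Qed.

Section fixed_noise.
Variable q : R.
Hypotheses (q0 : 0 <= q) (q1 : q < 1).

Let q2_lt1 : q ^+ 2 < 1. Proof. by rewrite expr_lt1. Qed.

Let d_gt0 : 0 < 1 - q ^+ 2. Proof. by rewrite subr_gt0. Qed.

Let d_neq0 : 1 - q ^+ 2 != 0. Proof. by rewrite gt_eqF. Qed.

Let c_gt0 : 0 < Num.sqrt (1 - q ^+ 2). Proof. by rewrite sqrtr_gt0. Qed.

Let c_sqr : Num.sqrt (1 - q ^+ 2) ^+ 2 = 1 - q ^+ 2.
Proof. by rewrite sqr_sqrtr// ltW. Qed.

(** For fixed [x] the exponent is [x^2 / 2] minus a square, so the kernel is
    bounded in [y], although it is not bounded jointly. *)
Lemma bm_mehler x : bmfun (mehler q x : borelR -> R).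
Proof.
split.
  apply: (@measurable_comp _ _ _ _ _ _ setT
    (fun p => mehler q p.1 p.2) setT (pair x)) => //.
  exact: measurable_mehler.
exists ((Num.sqrt (1 - q ^+ 2))^-1 * expR (x ^+ 2 / 2)) => y.
rewrite ger0_norm ?mehler_ge0// ler_pM2l ?invr_gt0// ler_expR.
rewrite -subr_ge0 (_ : _ - _ = (q * y - x) ^+ 2 / (2 * (1 - q ^+ 2))).
  by rewrite divr_ge0 ?sqr_ge0// mulr_ge0// ltW.
by field.
Qed.

Lemma integral_mehler x : \int[G]_y mehler q x y = 1.
Proof.
apply: EFin_inj; rewrite -bm_EFin; last exact: bm_mehler.
pose u := - (q ^+ 2 / (2 * (1 - q ^+ 2))).
pose b := q * x / (1 - q ^+ 2).
have u2 : u < 2^-1.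
  by rewrite (@le_lt_trans _ _ 0)// oppr_le0 divr_ge0 ?sqr_ge0// mulr_ge0// ltW.
have E : 1 - 2 * u = (1 - q ^+ 2)^-1 by rewrite /u; field.
transitivity (\int[G]_y (((Num.sqrt (1 - q ^+ 2))^-1 *
    expR (- (q * x) ^+ 2 / (2 * (1 - q ^+ 2))))%:E *
    (expR (u * y ^+ 2 + b * y))%:E))%E.
  apply: eq_integral => y _; rewrite -EFinM -mulrA -expRD; congr ((_ * expR _)%:E).
  by rewrite /u /b; field.
rewrite ge0_integralZl_EFin//; last first.
  apply/measurable_EFinP/measurableT_comp => //.
  by apply: measurable_funD; apply: measurable_funM => //; exact: measurable_funX.
rewrite gauss_integral_quad// -EFinM E sqrtrV ?ltW// invrK; congr EFin.
rewrite mulrACA -expRD mulVf ?gt_eqF// mul1r.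
by rewrite (_ : _ + _ = 0) ?expR0// /b; field.
Qed.

(** The Chapman-Kolmogorov equation, which makes two successive noises of
    correlation [q] one noise of correlation [q^2]. *)
Lemma mehler_mehler x v :
  \int[G]_y (mehler q x y * mehler q y v) = mehler (q ^+ 2) x v.
Proof.
apply: EFin_inj; rewrite -bm_EFin; last first.
  apply: bmM; first exact: bm_mehler.
  by under eq_fun do rewrite mehlerC; exact: bm_mehler.
pose u := - (q ^+ 2 / (1 - q ^+ 2)).
pose b := q * (x + v) / (1 - q ^+ 2).
have u2 : u < 2^-1.
  by rewrite (@le_lt_trans _ _ 0)// oppr_le0 divr_ge0 ?sqr_ge0// ltW.
have Q_gt0 : 0 < 1 + q ^+ 2 by rewrite ltr_pwDl// sqr_ge0.
have E : 1 - 2 * u = (1 + q ^+ 2) / (1 - q ^+ 2) by rewrite /u; field.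
transitivity (\int[G]_y (((1 - q ^+ 2)^-1 *
    expR (- (q ^+ 2 * (x ^+ 2 + v ^+ 2)) / (2 * (1 - q ^+ 2))))%:E *
    (expR (u * y ^+ 2 + b * y))%:E))%E.
  apply: eq_integral => y _; rewrite -EFinM /mehler mulrACA -expRD.
  rewrite -[in RHS]mulrA -expRD -invfM -expr2 c_sqr; congr ((_ * expR _)%:E).
  by rewrite /u /b; field.
rewrite ge0_integralZl_EFin ?mulr_ge0 ?expR_ge0 ?invr_ge0 ?(ltW d_gt0)//; last first.
  apply/measurable_EFinP/measurableT_comp => //.
  by apply: measurable_funD; apply: measurable_funM => //; exact: measurable_funX.
rewrite gauss_integral_quad// -EFinM E; congr EFin.
rewrite mulrACA -expRD /mehler.
have F : 1 - q ^+ 2 ^+ 2 = (1 + q ^+ 2) * (1 - q ^+ 2) by ring.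
congr (_ * expR _); last first.
  by rewrite F /b; field; rewrite d_neq0 gt_eqF.
rewrite F (sqrtrM _ (ltW Q_gt0)) (sqrtrM _ (ltW Q_gt0)) sqrtrV ?ltW//.
rewrite -{1}c_sqr; field.
by rewrite !gt_eqF// sqrtr_gt0.
Qed.

(** The substitution [y = q x + sqrt (1 - q^2) z]. *)
Lemma ge0_ou_mehler (f : borelR -> \bar R) x :
  measurable_fun [set: borelR] f -> (forall x, 0 <= f x)%E ->
  (\int[G]_z f (q * x + Num.sqrt (1 - q ^+ 2) * z)%R =
   \int[G]_y (f y * (mehler q x y)%:E))%E.
Proof.
move=> mf f0; set c := Num.sqrt _.
have maff : measurable_fun [set: borelR] (fun z : R => q * x + c * z).
  by apply: measurable_funD => //; exact: measurable_funM.
rewrite integral_normal_prob//; last exact: measurableT_comp.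
have mK : measurable_fun [set: borelR] (fun y => (mehler q x y)%:E).
  by apply/measurable_EFinP; exact: (bm_mehler x).1.
rewrite integral_normal_prob//; last 2 first.
  exact: emeasurable_funM.
  by move=> y; rewrite mule_ge0// lee_fin mehler_ge0.
pose h y := (f y * (c^-1 * normal_pdf 0 1 ((y - q * x) / c))%:E)%E.
transitivity (\int[leb]_y h y)%E; last first.
  apply: eq_integral => y _; rewrite /h -muleA -EFinM; congr (_ * _%:E)%E.
  rewrite !normal_pdfE ?oner_neq0// /normal_peak /normal_fun /mehler -/c.
  rewrite [RHS]mulrACA -expRD mulrA; congr (_ * expR _).
  rewrite subr0 expr_div_n c_sqr; field.
  by rewrite d_neq0.
have mh : measurable_fun [set: borelR] h.
  apply: emeasurable_funM => //; apply/measurable_EFinP/measurable_funM => //.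
  apply: measurableT_comp; first exact: measurable_normal_pdf.
  by apply: measurable_funM => //; exact: measurable_funB.
have h0 y : (0 <= h y)%E.
  by rewrite mule_ge0// lee_fin mulr_ge0 ?normal_pdf_ge0// invr_ge0 ltW.
rewrite (@ge0_integral_affine _ (q * x) c h)//.
rewrite -ge0_integralZl_EFin ?(ltW c_gt0)//; last exact: measurableT_comp.
apply: eq_integral => z _; rewrite /h muleCA -EFinM; congr (_ * _%:E)%E.
have -> : (q * x + c * z - q * x) / c = z by field; rewrite gt_eqF.
by field; rewrite gt_eqF.
Qed.

Lemma ou_mehler (g : borelR -> R) x : bmfun g ->
  \int[G]_z g (q * x + Num.sqrt (1 - q ^+ 2) * z) =
  \int[G]_y (g y * mehler q x y).
Proof.
move=> hg; have [_ [M hM]] := hg.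
have maff : measurable_fun [set: borelR] (fun z : R => q * x + Num.sqrt (1 - q ^+ 2) * z).
  by apply: measurable_funD => //; exact: measurable_funM.
have hg' := bm_comp hg maff.
have hK := bm_mehler x.
have hgM : bmfun (fun y => g y + M) by apply: bmD => //; exact: bm_cst.
have E : \int[G]_z (g (q * x + Num.sqrt (1 - q ^+ 2) * z) + M) =
    \int[G]_y ((g y + M) * mehler q x y).
  apply: EFin_inj; rewrite -bm_EFin; last by apply: bmD => //; exact: bm_cst.
  rewrite -bm_EFin; last exact: bmM.
  rewrite (@ge0_ou_mehler (fun y => (g y + M)%:E))//.
    by apply/measurable_EFinP; exact: hgM.1.
  by move=> y; rewrite lee_fin; have := hM y; rewrite ler_norml; lra.
move: E; rewrite EPD//; last exact: bm_cst.
rewrite EP_cst [RHS](@eq_EP _ _ _ _ _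
  (fun y => g y * mehler q x y + M * mehler q x y)); last first.
  by move=> y; rewrite mulrDl.
rewrite EPD; [|exact: bmM|by apply: bmM => //; exact: bm_cst].
by rewrite EPZl// integral_mehler mulr1 => /addIr.
Qed.

End fixed_noise.
End mehler.

(** * The Ornstein-Uhlenbeck operators on the line *)

Section ou.
Context {R : realType}.
Local Notation leb := (@lebesgue_measure R).
Local Notation borelR := (measurableTypeR R).
Local Notation G := (normal_prob (0 : R) 1).

(** With [Z] standard Gaussian, [h |-> E h (ou q x Z)] is the
    Ornstein-Uhlenbeck operator P_q, parametrized by correlation rather than
    by time. *)
Definition ou (q : R) (x z : borelR) : borelR := q * x + Num.sqrt (1 - q ^+ 2) * z.

Lemma measurable_ou d (T : measurableType d) q (a b : T -> borelR) :
  measurable_fun [set: T] a -> measurable_fun [set: T] b ->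
  measurable_fun [set: T] (fun x => ou q (a x) (b x)).
Proof. by move=> ma mb; apply: measurable_funD; exact: measurable_funM. Qed.

Section fixed_noise.
Variable q : R.
Hypotheses (q0 : 0 <= q) (q1 : q < 1).

(** The pair [(X, ou q X Z)] is exchangeable because its density with respect
    to the product measure, the Mehler kernel, is symmetric. *)
Lemma ou_sym (F : borelR -> borelR -> R) :
  bmfun (fun p : borelR * borelR => F p.1 p.2) ->
  \int[G]_x \int[G]_z F x (ou q x z) = \int[G]_x \int[G]_z F (ou q x z) x.
Proof.
(* Adding a constant to [F] makes it nonnegative, as Tonelli requires. *)
wlog F0 : F / forall x y, 0 <= F x y => [wlg|] hF.
  have [_ [M hM]] := hF.
  have hFM : bmfun (fun p : borelR * borelR => F p.1 p.2 + M).
    by apply: bmD => //; exact: bm_cst.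
  have := wlg (fun x y => F x y + M) _ hFM.
  have shift (a b : borelR * borelR -> borelR) : measurable_fun setT a ->
      measurable_fun setT b ->
      \int[G]_x \int[G]_z (F (a (x, z)) (b (x, z)) + M) =
      \int[G]_x \int[G]_z F (a (x, z)) (b (x, z)) + M.
    move=> ma mb.
    have hab : bmfun (fun p : borelR * borelR => F (a (p.1, p.2)) (b (p.1, p.2))).
      rewrite (_ : (fun _ => _) = fun p => F (a p) (b p)).
        exact: (bm_comp2 hF).
      by apply/funext => -[].
    rewrite -[in RHS](EP_cst G M) -EPD; last 2 first.
    - exact: (bm_int (F := fun x z => F (a (x, z)) (b (x, z))) hab).
    - exact: bm_cst.
    apply: eq_EP => x.
    have hx := bm_section1 (F := fun x z => F (a (x, z)) (b (x, z))) hab x.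
    by rewrite (EPD _ hx (bm_cst _ _)) EP_cst.
  have m1 : measurable_fun setT (fun p : borelR * borelR => p.1) by exact: measurable_fst.
  have mou : measurable_fun setT (fun p : borelR * borelR => ou q p.1 p.2).
    exact: measurable_ou.
  rewrite (shift _ _ m1 mou) (shift _ _ mou m1)/= => H; apply: addIr (H _).
  by move=> x y; have := hM (x, y); rewrite ler_norml/=; lra.
have K H : bmfun (fun p : borelR * borelR => H p.1 p.2) ->
    ((\int[G]_x \int[G]_z H x (ou q x z))%:E =
     \int[G]_x \int[G]_y (H x y * mehler q x y)%:E)%E.
  move=> hH; rewrite -bm_EFin; last first.
    apply: (bm_int (F := fun x z => H x (ou q x z))).
    by apply: (bm_comp2 hH) => //; exact: measurable_ou.
  apply: eq_integral => x _.
  rewrite ou_mehler// -?bm_EFin//; last exact: bm_section1.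
  by apply: bmM; [exact: bm_section1|exact: bm_mehler].
apply: EFin_inj; rewrite K// (K (fun x y => F y x)); last exact: (bm_comp2 hF).
rewrite (fubini_tonelli (fun p : borelR * borelR => (F p.1 p.2 * mehler q p.1 p.2)%:E))/=.
- by apply: eq_integral => y _; apply: eq_integral => x _; rewrite mehlerC.
- by apply/measurable_EFinP/measurable_funM; [exact: hF.1|exact: measurable_mehler].
- by move=> p; rewrite lee_fin mulr_ge0// mehler_ge0.
Qed.

Lemma ou_invariant (f : borelR -> R) : bmfun f ->
  \int[G]_x \int[G]_z f (ou q x z) = \int[G]_x f x.
Proof.
move=> hf; rewrite -(ou_sym (F := fun x _ => f x)); last exact: (bm_comp hf).
by apply: eq_EP => x; rewrite EP_cst.
Qed.

Lemma bm_ou_int (f : borelR -> R) : bmfun f -> bmfun (fun x => \int[G]_z f (ou q x z)).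
Proof.
move=> hf; apply: (bm_int (F := fun x z => f (ou q x z))).
by apply: (bm_comp hf); exact: measurable_ou.
Qed.

(** The semigroup property P_q P_q = P_(q^2). *)
Lemma ou_ou (f : borelR -> R) (x : R) : bmfun f ->
  \int[G]_z \int[G]_w f (ou q (ou q x z) w) = \int[G]_z f (ou (q ^+ 2) x z).
Proof.
have q2 : q ^+ 2 < 1 by rewrite expr_lt1.
wlog f0 : f / forall x, 0 <= f x => [wlg|] hf.
  have [_ [M hM]] := hf.
  have hfM : bmfun (fun x => f x + M) by apply: bmD => //; exact: bm_cst.
  have hou r y : bmfun (fun w => f (ou r y w)).
    by apply: (bm_comp hf); exact: measurable_ou.
  have L : \int[G]_z \int[G]_w (f (ou q (ou q x z) w) + M) =
      \int[G]_z \int[G]_w f (ou q (ou q x z) w) + M.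
    rewrite -[in RHS](EP_cst G M) -EPD; last 2 first.
    - by apply: (bm_comp (bm_ou_int hf)); exact: measurable_ou.
    - exact: bm_cst.
    by apply: eq_EP => z; rewrite (EPD _ (hou _ _) (bm_cst _ _)) EP_cst.
  have := wlg (fun x => f x + M) _ hfM.
  rewrite L (EPD _ (hou _ _) (bm_cst _ _)) EP_cst => H; apply/(@addIr R M)/H.
  by move=> y; have := hM y; rewrite ler_norml; lra.
have mK2 v : measurable_fun [set: borelR] (fun y : borelR => mehler q y v).
  by under eq_fun do rewrite mehlerC; exact: (bm_mehler _ _ v).1.
rewrite (@ou_mehler _ q q0 q1 (fun y => \int[G]_w f (ou q y w)) x); last exact: bm_ou_int.
rewrite (@ou_mehler _ (q ^+ 2) (sqr_ge0 q) q2 f x hf).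
apply: EFin_inj; rewrite -!bm_EFin; last 2 first.
- by apply: bmM => //; apply: bm_mehler => //; exact: sqr_ge0.
- by apply: bmM; [exact: bm_ou_int|exact: bm_mehler].
transitivity (\int[G]_y \int[G]_v (f v * mehler q y v * mehler q x y)%:E)%E.
  apply: eq_integral => y _; rewrite ou_mehler//.
  rewrite -EPZr; last by apply: bmM => //; exact: bm_mehler.
  rewrite -bm_EFin//; apply: bmM; last exact: bm_cst.
  by apply: bmM => //; exact: bm_mehler.
rewrite (fubini_tonelli (fun p : borelR * borelR =>
  (f p.2 * mehler q p.1 p.2 * mehler q x p.1)%:E))/=.
- apply: eq_integral => v _; rewrite -(@mehler_mehler _ q)// -EPZl.
    rewrite -bm_EFin; first by apply: eq_integral => y _; congr EFin; ring.
    apply: bmM; first exact: bm_cst.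
    by apply: bmM; [exact: bm_mehler|under eq_fun do rewrite mehlerC; exact: bm_mehler].
  by apply: bmM; [exact: bm_mehler|under eq_fun do rewrite mehlerC; exact: bm_mehler].
- apply/measurable_EFinP/measurable_funM.
    apply: measurable_funM; last exact: measurable_mehler.
    by apply: measurableT_comp => //; exact: hf.1.
  by apply: measurableT_comp => //; exact: (bm_mehler _ _ x).1.
- by move=> p; rewrite lee_fin !mulr_ge0// mehler_ge0.
Qed.

End fixed_noise.
End ou.

(** * Hypercontractivity on the line *)

(** Matching on the head symbol keeps unification from unfolding the
    function. *)
Ltac bm := repeat match goal with
  | |- bmfun (fun x => `|@?f x|) => apply: bm_norm
  | |- bmfun (fun x => @?f x + @?g x) => apply: bmD
  | |- bmfun (fun x => - @?f x) => apply: bmN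
  | |- bmfun (fun x => @?f x * @?g x) => apply: bmM
  | |- bmfun (fun x => @?f x ^+ _) => apply: bmX
  | |- bmfun _ => first [exact: bm_cst | assumption]
  end.

Section hyper1.
Context {R : realType}.
Local Notation borelR := (measurableTypeR R).
Local Notation G := (normal_prob (0 : R) 1).

(** [mehler (q ^+ 2) x x] is the squared L2 norm of [mehler q x]. Its square
    grows like [expR (u * x ^+ 2)] with [u = 2 q^2 / (1 + q^2)], which is
    integrable for small [q]; the excess [1/16] over the value [1] at [q = 0]
    is what [ou_hypercontractive] can afford. *)
Lemma integral_mehler_diag (q : R) : 0 <= q -> q <= 10^-1 ->
  (\int[G]_x (mehler (q ^+ 2) x x ^+ 2)%:E <= (17 / 16)%:E)%E.
Proof.
move=> q0 q10.
have t0 : 0 <= q ^+ 2 by exact: sqr_ge0.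
have t1 : q ^+ 2 <= 100^-1 by nra.
move: t0 t1; move: (q ^+ 2) => t t0 t1 {q q0 q10}.
have d0 : 0 < 1 - t ^+ 2 by nra.
have e0 : 0 < 1 + t by nra.
pose u := 2 * t / (1 + t).
have u1 : u <= 50^-1 by rewrite ler_pdivrMr//; lra.
have u2 : u < 2^-1 by lra.
have -> : (\int[G]_x (mehler t x x ^+ 2)%:E =
    \int[G]_x ((1 - t ^+ 2)^-1%:E * (expR (u * x ^+ 2 + 0 * x))%:E))%E.
  apply: eq_integral => x _; rewrite -EFinM /mehler exprMn exprVn sqr_sqrtr ?ltW//.
  rewrite -expRM_natl; congr ((_ * expR _)%:E).
  rewrite /u; field; rewrite gt_eqF//.
  by rewrite (_ : 1 - _ = (1 + t) * (1 - t)) ?gt_eqF//; [nra|ring].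
rewrite ge0_integralZl_EFin ?invr_ge0 ?(ltW d0)//; last first.
  apply/measurable_EFinP/measurableT_comp => //.
  by apply: measurable_funD; apply: measurable_funM => //; exact: measurable_funX.
rewrite gauss_integral_quad// -EFinM lee_fin expr0n mul0r expR0 mulr1 -invfM.
rewrite -[leRHS]invf_div lef_pV2 ?posrE; last 2 first.
- by rewrite mulr_gt0// sqrtr_gt0; lra.
- by rewrite divr_gt0.
have s1 : 97 / 100 <= Num.sqrt (1 - 2 * u).
  rewrite -[leLHS]ger0_norm -?sqrtr_sqr ?ler_sqrt; nra.
nra.
Qed.

Variable q : R.
Hypotheses (q0 : 0 <= q) (q10 : q <= 10^-1).

Let q1 : q < 1. Proof. by apply: le_lt_trans q10 _; rewrite invf_lt1// ltr1n. Qed.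

(** P_q maps L2 to L4 with norm one. Write [h = a + k] with [a] the mean of
    [h], and [w] for P_q k. Against a centred [k] the Mehler kernel may be
    replaced by the kernel minus one, so Cauchy-Schwarz bounds [w x ^+ 2] by
    [E k^2] times [mehler (q ^+ 2) x x - 1]. For small [q] this makes the L4
    norm of [w] at most half the L2 norm of [k], and that gain absorbs every
    cross term in the expansion of [(a + w) ^+ 4], the linear one being
    zero. *)
Lemma ou_hypercontractive (h : borelR -> R) : bmfun h ->
  \int[G]_x ((\int[G]_z h (ou q x z)) ^+ 4) <= (\int[G]_x (h x ^+ 2)) ^+ 2.
Proof.
move=> hh.
set a := \int[G]_x h x.
pose k x := h x - a.
have hk : bmfun k by rewrite /k; bm.
set b := \int[G]_x (k x ^+ 2).
have b0 : 0 <= b by apply: EP_ge0 => x; exact: sqr_ge0.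
have k0 : \int[G]_x k x = 0 by rewrite /k EPB ?EP_cst ?subrr//; bm.
have h2 : \int[G]_x (h x ^+ 2) = a ^+ 2 + b.
  rewrite (@eq_EP _ _ _ _ _ (fun x : borelR => a ^+ 2 + 2 * a * k x + k x ^+ 2)); last first.
    by move=> x; rewrite /k; ring.
  by rewrite !EPD ?EP_cst ?EPZl ?k0 ?mulr0 ?addr0//; bm.
pose w x := \int[G]_z k (ou q x z).
have hw : bmfun w by exact: bm_ou_int.
have w0 : \int[G]_x w x = 0 by rewrite /w ou_invariant.
have hou x : bmfun (fun z => k (ou q x z)).
  by apply: (bm_comp hk); exact: measurable_ou.
have hE x : \int[G]_z h (ou q x z) = a + w x.
  rewrite (@eq_EP _ _ _ _ _ (fun z : borelR => a + k (ou q x z))); last first.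
    by move=> z; rewrite /k; ring.
  by rewrite EPD ?EP_cst//; bm.
pose L x := mehler (q ^+ 2) x x.
have hK x : bmfun (mehler q x : borelR -> R) by exact: bm_mehler.
have wL x : w x ^+ 2 <= b * (L x - 1) /\ 1 <= L x.
  have hKx := hK x.
  have KL : \int[G]_y ((mehler q x y - 1) ^+ 2) = L x - 1.
    rewrite (@eq_EP _ _ _ _ _ (fun y : borelR => mehler q x y * mehler q y x +
        ((-2) * mehler q x y + 1))); last first.
      by move=> y; rewrite (mehlerC q y x); ring.
    have hKK : bmfun (fun y => mehler q x y * mehler q y x : R).
      by apply: bmM; [exact: hK|under eq_fun do rewrite mehlerC; exact: hK].
    rewrite !EPD ?EP_cst ?(EPZl _ _ hKx) ?integral_mehler ?mehler_mehler//; try by bm.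
    by rewrite /L; ring.
  split; last first.
    by rewrite -subr_ge0 -KL; apply: EP_ge0 => y; exact: sqr_ge0.
  rewrite -KL (_ : w x = \int[G]_y (k y * (mehler q x y - 1))).
    apply: cauchy_schwarz => //.
    by bm.
  rewrite /w ou_mehler//.
  rewrite [RHS](@eq_EP _ _ _ _ _ (fun y : borelR => k y * mehler q x y - k y)); last first.
    by move=> y; ring.
  by rewrite EPB ?k0 ?subr0//; apply: bmM.
have w4 : \int[G]_x (w x ^+ 4) <= b ^+ 2 / 16.
  (* As [1 <= L], [(L - 1)^2 <= L^2 - 1]; the [1] is moved to the other side
     so that both integrands are nonnegative. *)
  rewrite (_ : b ^+ 2 / 16 = b ^+ 2 * (17 / 16) - b ^+ 2); last by field.
  rewrite lerBrDr -[X in _ + X <= _](EP_cst G) -EPD; [|by bm..].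
  rewrite -lee_fin -bm_EFin; last by bm.
  rewrite EFinM.
  apply: (@le_trans _ _ ((b ^+ 2)%:E * \int[G]_x (L x ^+ 2)%:E)%E); last first.
    by rewrite lee_wpmul2l ?lee_fin ?sqr_ge0//; exact: integral_mehler_diag.
  have mL : measurable_fun [set: borelR] L.
    apply: (@measurableT_comp _ _ _ _ _ _
      (fun p : borelR * borelR => mehler (q ^+ 2) p.1 p.2) _ (fun x => (x, x))).
      exact: measurable_mehler.
    exact: measurable_fun_pair.
  have mL2 : measurable_fun [set: borelR] (fun x => (L x ^+ 2)%:E).
    by apply/measurable_EFinP; exact: measurable_funX.
  rewrite -ge0_integralZl_EFin ?sqr_ge0//; last first.
    by move=> x _; rewrite lee_fin sqr_ge0.
  apply: ge0_le_integral => //.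
  - move=> x _; rewrite lee_fin addr_ge0 ?sqr_ge0//.
    by rewrite (_ : 4 = 2 * 2)%N // exprM sqr_ge0.
  - by apply/measurable_EFinP; apply: (_ : bmfun _).1; bm.
  - exact: emeasurable_funM.
  - move=> x _; rewrite -EFinM lee_fin.
    have [] := wL x; move: (L x) (w x) => l v H1 H2.
    have : (v ^+ 2) ^+ 2 <= (b * (l - 1)) ^+ 2.
      by rewrite ler_sqr ?nnegrE ?sqr_ge0// mulr_ge0// subr_ge0.
    nra.
have w2 : \int[G]_x (w x ^+ 2) <= b / 4.
  have := jensen_sqr G (bmX 2 hw).
  rewrite (@eq_EP _ _ _ _ (fun x : borelR => (w x ^+ 2) ^+ 2) (fun x => w x ^+ 4)); last first.
    by move=> x; rewrite -exprM.
  move=> H; rewrite -ler_sqr ?nnegrE; last 2 first.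
  - by apply: EP_ge0 => x; exact: sqr_ge0.
  - by rewrite divr_ge0.
  by apply: le_trans H (le_trans w4 _); rewrite expr_div_n ler_pdivrMr//; nra.
(* The cubic term is removed by [2 w^2 (a - w)^2 >= 0]. *)
apply: (@le_trans _ _ (\int[G]_x ((a ^+ 4 + 4 * a ^+ 3 * w x) +
    (8 * a ^+ 2 * w x ^+ 2 + 3 * w x ^+ 4)))).
  apply: EP_le; [by under eq_fun do rewrite hE; bm|by bm|].
  move=> x; rewrite hE; have := sqr_ge0 (w x * (a - w x)).
  by move: (w x) => v; nra.
rewrite !EPD ?EP_cst ?EPZl ?w0; try by bm.
rewrite h2 mulr0 addr0.
move: w2 w4; set W2 := \int[G]_x _; set W4 := \int[G]_x _ => w2 w4.
have a2 : 0 <= a ^+ 2 by exact: sqr_ge0.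
nra.
Qed.

End hyper1.

(** * Gaussian vectors and coordinatewise noise *)

Section tuples.
Context {R : realType}.
Local Notation borelR := (measurableTypeR R).
Local Notation G := (normal_prob (0 : R) 1).
Local Notation "'γ' n" := (gaussian R n) (at level 10, n at level 9).

Definition tcons n (x : borelR) (t : n.-tuple borelR) : n.+1.-tuple borelR :=
  pair_cons (x, t).

Definition mix n (q : R) (t z : n.-tuple borelR) : n.-tuple borelR :=
  [tuple ou q (tnth t i) (tnth z i) | i < n].

Lemma tconsE n (t : n.+1.-tuple borelR) : t = tcons (thead t) [tuple of behead t].
Proof. by rewrite [LHS]tuple_eta; exact/val_inj. Qed.

Lemma tnth_tcons0 n x (t : n.-tuple borelR) : tnth (tcons x t) ord0 = x.
Proof. by []. Qed.

Lemma tnth_tconsS n x (t : n.-tuple borelR) i : tnth (tcons x t) (lift ord0 i) = tnth t i.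
Proof. by rewrite tnthS. Qed.

Lemma mix_tcons n q x y (t z : n.-tuple borelR) :
  mix q (tcons x t) (tcons y z) = tcons (ou q x y) (mix q t z).
Proof.
apply: eq_from_tnth => i; rewrite tnth_mktuple.
by case: (unliftP ord0 i) => [j ->|->]; rewrite ?tnth_tconsS ?tnth_tcons0 ?tnth_mktuple.
Qed.

Definition upd n (i : 'I_n) (t : n.-tuple borelR) (y : borelR) : n.-tuple borelR :=
  [tuple if j == i then y else tnth t j | j < n].

Lemma upd0_tcons n x (t : n.-tuple borelR) y : upd ord0 (tcons x t) y = tcons y t.
Proof.
apply: eq_from_tnth => i; rewrite tnth_mktuple.
by case: (unliftP ord0 i) => [j ->|->]; rewrite ?tnth_tconsS ?tnth_tcons0.
Qed.

Lemma updS_tcons n (i : 'I_n) x (t : n.-tuple borelR) y :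
  upd (lift ord0 i) (tcons x t) y = tcons x (upd i t y).
Proof.
apply: eq_from_tnth => j; rewrite tnth_mktuple.
case: (unliftP ord0 j) => [k ->|->]; rewrite ?tnth_tconsS ?tnth_tcons0//.
by rewrite tnth_mktuple (inj_eq (@lift_inj _ ord0)).
Qed.

Section measurability.
Context d (T : measurableType d).

Lemma measurable_fst_comp d1 d2 (T1 : measurableType d1) (T2 : measurableType d2)
    (a : T -> T1 * T2) :
  measurable_fun [set: T] a -> measurable_fun [set: T] (fun x => (a x).1).
Proof. by move=> ma; exact: measurableT_comp. Qed.

Lemma measurable_snd_comp d1 d2 (T1 : measurableType d1) (T2 : measurableType d2)
    (a : T -> T1 * T2) :
  measurable_fun [set: T] a -> measurable_fun [set: T] (fun x => (a x).2).
Proof. by move=> ma; exact: measurableT_comp. Qed.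

Lemma measurable_tcons n (a : T -> borelR) (b : T -> n.-tuple borelR) :
  measurable_fun [set: T] a -> measurable_fun [set: T] b ->
  measurable_fun [set: T] (fun x => tcons (a x) (b x)).
Proof. by move=> ma mb; exact: measurable_cons. Qed.

Lemma measurable_mix n q (a b : T -> n.-tuple borelR) :
  measurable_fun [set: T] a -> measurable_fun [set: T] b ->
  measurable_fun [set: T] (fun x => mix q (a x) (b x)).
Proof.
move=> ma mb; apply/measurable_fun_tnthP => i.
rewrite (_ : _ \o _ = fun x => ou q (tnth (a x) i) (tnth (b x) i)).
  have mi : measurable_fun [set: n.-tuple borelR] (fun t => tnth t i) := measurable_tnth i.
  by apply: measurable_ou;
    [exact: (measurableT_comp mi ma)|exact: (measurableT_comp mi mb)].
by apply/funext => x; rewrite /= tnth_mktuple.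
Qed.

Lemma measurable_upd n (i : 'I_n) (a : T -> n.-tuple borelR)
    (b : T -> borelR) :
  measurable_fun [set: T] a -> measurable_fun [set: T] b ->
  measurable_fun [set: T] (fun x => upd i (a x) (b x)).
Proof.
move=> ma mb; apply/measurable_fun_tnthP => j.
rewrite (_ : _ \o _ = fun x => if j == i then b x else tnth (a x) j); last first.
  by apply/funext => x; rewrite /= tnth_mktuple.
case: eqP => // _.
exact: (measurableT_comp (measurable_tnth j) ma).
Qed.

End measurability.

End tuples.

Ltac meas := repeat match goal with
  | |- measurable_fun _ (fun x => tcons (@?a x) (@?b x)) => apply: measurable_tcons
  | |- measurable_fun _ (fun x => mix _ (@?a x) (@?b x)) => apply: measurable_mix
  | |- measurable_fun _ (fun x => upd _ (@?a x) (@?b x)) => apply: measurable_upd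
  | |- measurable_fun _ (fun x => ou _ (@?a x) (@?b x)) => apply: measurable_ou
  | |- measurable_fun _ (fun x => (@?a x).1) => apply: measurable_fst_comp
  | |- measurable_fun _ (fun x => (@?a x).2) => apply: measurable_snd_comp
  | |- measurable_fun _ _ => 
    first [ exact: measurable_id | exact: measurable_cst | apply: measurable_tcons
          | apply: measurable_mix | apply: measurable_upd | apply: measurable_ou
          | exact: measurable_fst | exact: measurable_snd | assumption ]
  end.

(** [h] states that the functions at the leaves are bounded and
    measurable. *)
Ltac bmc h := cbv beta; repeat match goal with
  | |- bmfun (fun x => `|@?f x|) => apply: bm_norm
  | |- bmfun (fun x => @?f x + @?g x) => apply: bmD
  | |- bmfun (fun x => - @?f x) => apply: bmN
  | |- bmfun (fun x => @?f x * @?g x) => apply: bmM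
  | |- bmfun (fun x => @?f x ^+ _) => apply: bmX
  | |- bmfun (fun x => Rintegral _ _ (@?f x)) => apply: bm_int; cbv beta
  | |- bmfun _ =>
    first [exact: bm_cst | apply: (bm_comp2 h) | apply: (bm_comp h) | assumption]
  end; meas.

(** Minkowski's inequality for [phi ^+ 2]: expand the outer square into a
    double integral and apply Cauchy-Schwarz in [t]. It exchanges an L2 norm
    in [y] with an L4 norm in [t], which is the step that lets
    hypercontractivity tensorize. *)
Lemma minkowski_sqr {R : realType} d1 d2 (T1 : measurableType d1)
    (T2 : measurableType d2) (P1 : probability T1 R) (P2 : probability T2 R)
    (phi : T1 -> T2 -> R) (alpha : T1 -> R) :
  bmfun (fun p => phi p.1 p.2) -> bmfun alpha -> (forall y, 0 <= alpha y) ->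
  (forall y, \int[P2]_t (phi y t ^+ 4) <= alpha y ^+ 2) ->
  \int[P2]_t ((\int[P1]_y (phi y t ^+ 2)) ^+ 2) <= (\int[P1]_y alpha y) ^+ 2.
Proof.
move=> hphi halpha alpha0 step.
rewrite [leLHS](_ : _ =
  \int[P1]_y \int[P1]_y' \int[P2]_t (phi y t ^+ 2 * phi y' t ^+ 2)); last first.
  transitivity (\int[P2]_t \int[P1]_y \int[P1]_y' (phi y t ^+ 2 * phi y' t ^+ 2)).
    apply: eq_EP => t; rewrite expr2 -EPZr; last by bmc hphi.
    by apply: eq_EP => y; rewrite -EPZl//; bmc hphi.
  rewrite EP_fubini; last by bmc hphi.
  by apply: eq_EP => y; rewrite EP_fubini//; bmc hphi.
rewrite [leRHS](_ : _ = \int[P1]_y \int[P1]_y' (alpha y * alpha y')); last first.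
  by rewrite expr2 -EPZr//; apply: eq_EP => y; rewrite -EPZl.
apply: EP_le; [by bmc hphi|by bmc halpha|move=> y].
apply: EP_le; [by bmc hphi|by bmc halpha|move=> y'].
rewrite -ler_sqr ?nnegrE; last 2 first.
- by apply: EP_ge0 => t; rewrite mulr_ge0// sqr_ge0.
- by rewrite mulr_ge0.
apply: le_trans (cauchy_schwarz _ _ _) _; [by bmc hphi|by bmc hphi|].
rewrite exprMn; apply: ler_pM.
- by apply: EP_ge0 => t; exact: sqr_ge0.
- by apply: EP_ge0 => t; exact: sqr_ge0.
- by apply: le_trans (step y); under eq_EP do rewrite -exprM.
- by apply: le_trans (step y'); under eq_EP do rewrite -exprM.
Qed.

Section gauss_tuple.
Context {R : realType}.
Local Notation borelR := (measurableTypeR R).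
Local Notation G := (normal_prob (0 : R) 1).
Local Notation "'γ' n" := (gaussian R n) (at level 10, n at level 9).

Lemma gaussian0 (f : 0.-tuple borelR -> R) : bmfun f ->
  \int[γ 0]_t f t = f [tuple].
Proof.
move=> hf; rewrite /Rintegral integral_dirac//.
  by rewrite diracT mul1e.
by apply/measurable_EFinP; exact: hf.1.
Qed.

Lemma gaussianS n (f : n.+1.-tuple borelR -> R) : bmfun f ->
  \int[γ n.+1]_t f t = \int[G]_x \int[γ n]_t f (tcons x t).
Proof.
move=> hf.
have hf' : bmfun (fun p => f (tcons p.1 p.2)) by bmc hf.
rewrite -(EP_pair (F := fun x t => f (tcons x t)) hf').
rewrite /Rintegral integral_distribution; last 2 first.
- by apply/measurable_EFinP; exact: hf.1.
- rewrite (_ : _ \o _ = EFin \o fun p => f (tcons p.1 p.2)).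
    exact: bm_integrable.
  by apply/funext => -[].
by congr fine; apply: eq_integral => -[].
Qed.

Section noise.
Variable q : R.
Hypotheses (q0 : 0 <= q) (q1 : q < 1).

Lemma mix_sym n (F : n.-tuple borelR -> n.-tuple borelR -> R) :
  bmfun (fun p => F p.1 p.2) ->
  \int[γ n]_t \int[γ n]_z F t (mix q t z) = \int[γ n]_t \int[γ n]_z F (mix q t z) t.
Proof.
elim: n F => [|n IH] F hF.
  by apply: eq_EP => t; apply: eq_EP => z; rewrite !(tuple0 t) !(tuple0 (mix _ _ _)).
have expand (H : n.+1.-tuple borelR -> n.+1.-tuple borelR -> R) :
    bmfun (fun p => H p.1 p.2) ->
    \int[γ n.+1]_t \int[γ n.+1]_z H t (mix q t z) =
    \int[G]_x \int[G]_y \int[γ n]_t \int[γ n]_z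
      H (tcons x t) (tcons (ou q x y) (mix q t z)).
  move=> hH; rewrite gaussianS; last by bmc hH.
  apply: eq_EP => x; rewrite [RHS]EP_fubini; last by bmc hH.
  apply: eq_EP => t; rewrite gaussianS; last by bmc hH.
  by apply: eq_EP => y; apply: eq_EP => z; rewrite mix_tcons.
rewrite expand// (expand (fun t u => F u t)); last by bmc hF.
pose H x y := \int[γ n]_t \int[γ n]_z F (tcons x (mix q t z)) (tcons y t).
have hH : bmfun (fun p => H p.1 p.2) by rewrite /H; bmc hF.
transitivity (\int[G]_x \int[G]_y H x (ou q x y)); last exact: ou_sym.
apply: eq_EP => x; apply: eq_EP => y.
by apply: (IH (fun t u => F (tcons x t) (tcons (ou q x y) u))); bmc hF.
Qed.

Lemma mix_invariant n (f : n.-tuple borelR -> R) : bmfun f ->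
  \int[γ n]_t \int[γ n]_z f (mix q t z) = \int[γ n]_t f t.
Proof.
move=> hf; rewrite -(@mix_sym n (fun t _ => f t)); last by bmc hf.
by apply: eq_EP => t; rewrite EP_cst.
Qed.

Lemma mix_mix n (f : n.-tuple borelR -> R) t : bmfun f ->
  \int[γ n]_z \int[γ n]_w f (mix q (mix q t z) w) = \int[γ n]_z f (mix (q ^+ 2) t z).
Proof.
elim: n f t => [|n IH] f t hf.
  rewrite !gaussian0; [|by bmc hf..].
  by congr f; rewrite !(tuple0 (mix _ _ _)).
rewrite (tconsE t); move: (thead t) [tuple of behead t] => x s {t}.
rewrite gaussianS; last by bmc hf.
transitivity (\int[G]_y \int[G]_y' \int[γ n]_z \int[γ n]_w
    f (tcons (ou q (ou q x y) y') (mix q (mix q s z) w))).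
  apply: eq_EP => y; rewrite [RHS]EP_fubini; last by bmc hf.
  apply: eq_EP => z; rewrite gaussianS; last by bmc hf.
  by apply: eq_EP => y'; apply: eq_EP => w; rewrite !mix_tcons.
pose H v := \int[γ n]_z f (tcons v (mix (q ^+ 2) s z)).
have hH : bmfun H by rewrite /H; bmc hf.
transitivity (\int[G]_y \int[G]_y' H (ou q (ou q x y) y')).
  apply: eq_EP => y; apply: eq_EP => y'.
  by apply: (IH (fun u => f (tcons (ou q (ou q x y) y') u))); bmc hf.
rewrite ou_ou// gaussianS; last by bmc hf.
by apply: eq_EP => y; apply: eq_EP => z; rewrite mix_tcons.
Qed.

End noise.

(** Tensorization, one coordinate at a time: [ou_hypercontractive] in the
    first coordinate with the others fixed, [minkowski_sqr] to exchange the
    norms, then the induction hypothesis. The norm has to be exactly one,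
    since it is raised to the power [n]. *)
Lemma mix_hypercontractive n q (h : n.-tuple borelR -> R) :
  0 <= q -> q <= 10^-1 -> bmfun h ->
  \int[γ n]_t ((\int[γ n]_z h (mix q t z)) ^+ 4) <= (\int[γ n]_t (h t ^+ 2)) ^+ 2.
Proof.
move=> q0 q10; elim: n h => [|n IH] h hh.
  rewrite !gaussian0; [|by bmc hh..].
  by rewrite !(tuple0 (mix _ _ _)) -exprM.
rewrite !gaussianS; [|by bmc hh..].
pose phi y t := \int[γ n]_z h (tcons y (mix q t z)).
pose alpha y := \int[γ n]_t (h (tcons y t) ^+ 2).
have hphi : bmfun (fun p => phi p.1 p.2) by rewrite /phi; bmc hh.
have halpha : bmfun alpha by rewrite /alpha; bmc hh.
have alpha0 y : 0 <= alpha y by apply: EP_ge0 => t; exact: sqr_ge0.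
have step y : \int[γ n]_t (phi y t ^+ 4) <= alpha y ^+ 2.
  by apply: IH; bmc hh.
apply: (@le_trans _ _ (\int[γ n]_t ((\int[G]_y (phi y t ^+ 2)) ^+ 2))).
  rewrite EP_fubini; last by bmc hh.
  apply: EP_le; [by bmc hh|by bmc hphi|move=> t].
  apply: le_trans (ou_hypercontractive q0 q10 (h := phi ^~ t) _); last by bmc hphi.
  rewrite le_eqVlt; apply/orP; left; apply/eqP; apply: eq_EP => x.
  congr (_ ^+ 4); rewrite gaussianS; last by bmc hh.
  by apply: eq_EP => y; apply: eq_EP => z; rewrite mix_tcons.
exact: minkowski_sqr.
Qed.

End gauss_tuple.

(** * The martingale decomposition of the noise covariance *)

Section martingale.
Context {R : realType}.
Local Notation borelR := (measurableTypeR R).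
Local Notation G := (normal_prob (0 : R) 1).
Local Notation "'γ' n" := (gaussian R n) (at level 10, n at level 9).

(** The L1 influence of coordinate [i]. It is at most a constant times the mean
    of [`|partial f i|] ([influence1_le]), but it makes sense without
    derivatives and can only decrease when other coordinates are averaged
    out. *)
Definition influence1 n (f : n.-tuple borelR -> R) (i : 'I_n) : R :=
  \int[γ n]_t \int[G]_y `|f t - f (upd i t y)|.

Definition noise_cov n (q : R) (f : n.-tuple borelR -> R) : R :=
  \int[γ n]_t \int[γ n]_z (f t * f (mix q t z)) - (\int[γ n]_t f t) ^+ 2.

Definition gvar n (f : n.-tuple borelR -> R) : R :=
  \int[γ n]_t (f t ^+ 2) - (\int[γ n]_t f t) ^+ 2.

Lemma ler_sqrW (u v : R) : 0 <= u -> u <= v -> u ^+ 2 <= v ^+ 2.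
Proof. by move=> u0 uv; rewrite ler_sqr// nnegrE (le_trans u0). Qed.

(** The inequality of arithmetic and geometric means with weights 1/4 and
    3/4. *)
Lemma amgm31 (X A B : R) : 0 <= A -> 0 <= B ->
  X ^+ 4 <= A * B ^+ 3 -> X <= (A + 3 * B) / 4.
Proof.
move=> A0 B0 H; set m := _ / 4; rewrite leNgt; apply/negP => mX.
have m0 : 0 <= m by rewrite /m; lra.
have Am : A = 4 * m - 3 * B by rewrite /m; field.
have X4 : m ^+ 4 < X ^+ 4 by rewrite ltrXn2r.
(* The polynomial form of [A * B ^+ 3 <= m ^+ 4]. *)
  have : 0 <= (m - B) ^+ 2 * (m ^+ 2 + 2 * m * B + 3 * B ^+ 2).
  by apply: mulr_ge0; [exact: sqr_ge0|nra].
rewrite (_ : _ * _ = m ^+ 4 - (4 * m - 3 * B) * B ^+ 3); last by ring.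
rewrite -Am subr_ge0 => K.
by have := lt_le_trans X4 (le_trans H K); rewrite ltxx.
Qed.

Variable q : R.
Hypotheses (q0 : 0 <= q) (q10 : q <= 10^-1).

Let q1 : q < 1. Proof. by apply: le_lt_trans q10 _; rewrite invf_lt1// ltr1n. Qed.

(** With [u = |D|] and [Pu] its noisy average, Cauchy-Schwarz used twice gives
    [E[u Pu]^4 <= (E u)^2 (E u^2) E[Pu^4]], and hypercontractivity bounds the
    last factor by [(E u^2)^2]. The free parameter [lam] makes the resulting
    bound linear in [(E u)^2] and [E u^2], so that it can be summed over
    martingale differences; optimizing it at the end replaces Hoelder's
    inequality. *)
Lemma noise_form_le n (D : n.-tuple borelR -> R) (lam : R) : bmfun D -> 0 < lam ->
  \int[γ n]_t \int[γ n]_z (D t * D (mix q t z)) <=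
  lam ^+ 3 / 4 * (\int[γ n]_t `|D t|) ^+ 2 + 3 / (4 * lam) * \int[γ n]_t (D t ^+ 2).
Proof.
move=> hD lam0.
set a := \int[γ n]_t `|D t|; set b := \int[γ n]_t (D t ^+ 2).
have a0 : 0 <= a by apply: EP_ge0.
have b0 : 0 <= b by apply: EP_ge0 => t; exact: sqr_ge0.
pose Pu t := \int[γ n]_z `|D (mix q t z)|.
have hPu : bmfun Pu by rewrite /Pu; bmc hD.
have Pu0 t : 0 <= Pu t by apply: EP_ge0.
have bb : \int[γ n]_t (`|D t| ^+ 2) = b by apply: eq_EP => t; rewrite real_normK// num_real.
have H4 : \int[γ n]_t (Pu t ^+ 4) <= b ^+ 2.
  by rewrite -bb; apply: mix_hypercontractive => //; bmc hD.
pose X := \int[γ n]_t (`|D t| * Pu t).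
have X0 : 0 <= X by apply: EP_ge0 => t; rewrite mulr_ge0.
pose Y := \int[γ n]_t (`|D t| * Pu t ^+ 2).
have Y0 : 0 <= Y by apply: EP_ge0 => t; rewrite mulr_ge0// sqr_ge0.
have XY : X ^+ 2 <= a * Y.
  have := @weighted_cauchy_schwarz _ _ _ (γ n) (fun t => `|D t|) (fun=> 1) Pu.
  rewrite (@eq_EP _ _ _ _ _ (fun t => `|D t| * Pu t)); last by move=> t; rewrite mul1r.
  rewrite (@eq_EP _ _ _ _ (fun t => `|D t| * 1 ^+ 2) (fun t => `|D t|)); last first.
    by move=> t; rewrite expr1n mulr1.
  by apply => //; bmc hD.
have Y2 : Y ^+ 2 <= b ^+ 3.
  have := @cauchy_schwarz _ _ _ (γ n) (fun t => `|D t|) (fun t => Pu t ^+ 2).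
  rewrite bb => /(_ _ _) H; apply: le_trans (H _ _) _; [by bmc hD|by bmc hPu|].
  rewrite exprS ler_wpM2l//; apply: le_trans H4.
  by under eq_EP do rewrite -exprM.
have X4 : X ^+ 4 <= (lam ^+ 3 * a ^+ 2) * (b / lam) ^+ 3.
  rewrite [leRHS](_ : _ = a ^+ 2 * b ^+ 3); last by field; rewrite gt_eqF.
  rewrite (exprM X 2 2); apply: (@le_trans _ _ ((a * Y) ^+ 2)).
    by rewrite ler_sqr ?nnegrE ?sqr_ge0// mulr_ge0.
  by rewrite exprMn ler_wpM2l ?sqr_ge0.
have XX : \int[γ n]_t \int[γ n]_z (D t * D (mix q t z)) <= X.
  apply: EP_le; [by bmc hD|by bmc hD|move=> t].
  rewrite -EPZl; last by bmc hD.
  apply: EP_le; [by bmc hD|by bmc hD|move=> z].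
  by rewrite -normrM ler_norm.
apply: (le_trans XX); apply: le_trans (amgm31 _ _ X4) _.
- by rewrite mulr_ge0 ?sqr_ge0// exprn_ge0// ltW.
- by rewrite divr_ge0// ltW.
by rewrite le_eqVlt; apply/orP; left; apply/eqP; field; rewrite gt_eqF.
Qed.

(** Induction on the number of coordinates. The function [fbar] averages out
    the first coordinate and [D], the first martingale difference, is what is
    left. Since [D] has mean zero in the first coordinate, it stays orthogonal
    to functions of the other coordinates after noise, so the noise covariance
    and the variance both split into a contribution of [D], which
    [noise_form_le] bounds, and the same quantity for [fbar]. *)
Lemma noise_cov_le n (f : n.-tuple borelR -> R) (lam : R) : bmfun f -> 0 < lam ->
  noise_cov q f <=
  lam ^+ 3 / 4 * \sum_(i < n) influence1 f i ^+ 2 + 3 / (4 * lam) * gvar f.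
Proof.
move=> + lam0; elim: n f => [|n IH] f hf.
  rewrite big_ord0 /noise_cov /gvar !gaussian0; [|by bmc hf..].
  by rewrite (tuple0 (mix _ _ _)) -expr2 subrr !mulr0 addr0.
pose fbar t := \int[G]_x f (tcons x t).
have hfbar : bmfun fbar by rewrite /fbar; bmc hf.
(* [g] is [fbar] seen as a function of all the coordinates. *)
pose g (s : n.+1.-tuple borelR) := fbar [tuple of behead s].
have hg : bmfun g by apply: (bm_comp hfbar); exact: measurable_behead.
have gE x t : g (tcons x t) = fbar t by rewrite /g; congr fbar; exact/val_inj.
pose D s := f s - g s.
have hD : bmfun D by rewrite /D; bm.
clearbody g.
have DE x t : D (tcons x t) = f (tcons x t) - fbar t by rewrite /D gE.
have D0 t : \int[G]_x D (tcons x t) = 0.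
  under eq_EP do rewrite DE.
  by rewrite EPB ?EP_cst ?subrr//; bmc hf.
have fE s : f s = D s + g s by rewrite /D subrK.
clearbody D.
have mean : \int[γ n.+1]_s f s = \int[γ n]_t fbar t.
  by rewrite gaussianS// EP_fubini//; bmc hf.
have Dg0 : \int[γ n.+1]_s (D s * g s) = 0.
  rewrite gaussianS; last by bm.
  under eq_EP do under eq_EP do rewrite gE.
  rewrite EP_fubini; last by apply: bmM; [bmc hD|bmc hfbar].
  rewrite (@eq_EP _ _ _ _ _ (fun=> 0)) ?EP_cst// => t.
  by rewrite EPZr ?D0 ?mul0r//; bmc hD.
have cross : \int[γ n.+1]_s \int[γ n.+1]_u (D s * g (mix q s u)) = 0.
  rewrite gaussianS; last by apply: bm_int; apply: bmM; [bmc hD|bmc hg].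
  pose E t := \int[γ n]_z fbar (mix q t z).
  have hE : bmfun E by rewrite /E; bmc hfbar.
  transitivity (\int[G]_x \int[γ n]_t (D (tcons x t) * E t)).
    apply: eq_EP => x; apply: eq_EP => t; rewrite EPZl; last by bmc hg.
    congr (_ * _); rewrite gaussianS; last by bmc hg.
    rewrite -[RHS](EP_cst G); apply: eq_EP => y; apply: eq_EP => z.
    by rewrite mix_tcons gE.
  rewrite EP_fubini; last by apply: bmM; [bmc hD|bmc hE].
  rewrite (@eq_EP _ _ _ _ _ (fun=> 0)) ?EP_cst// => t.
  by rewrite EPZr ?D0 ?mul0r//; bmc hD.
have cross' : \int[γ n.+1]_s \int[γ n.+1]_u (g s * D (mix q s u)) = 0.
  rewrite (mix_sym q0 q1 (F := fun s u => g s * D u)); last first.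
    by apply: bmM; [bmc hg|bmc hD].
  by rewrite -cross; apply: eq_EP => s; apply: eq_EP => u; rewrite mulrC.
have gg : \int[γ n.+1]_s \int[γ n.+1]_u (g s * g (mix q s u)) =
    \int[γ n]_t \int[γ n]_z (fbar t * fbar (mix q t z)).
  rewrite gaussianS; last by bmc hg.
  rewrite -[RHS](EP_cst G); apply: eq_EP => x; apply: eq_EP => t.
  rewrite gaussianS; last by bmc hg.
  rewrite -[RHS](EP_cst G); apply: eq_EP => y; apply: eq_EP => z.
  by rewrite mix_tcons !gE.
have g2 : \int[γ n.+1]_s (g s ^+ 2) = \int[γ n]_t (fbar t ^+ 2).
  rewrite gaussianS; last by bmc hg.
  rewrite -[RHS](EP_cst G); apply: eq_EP => x; apply: eq_EP => t.
  by rewrite gE.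
have covE : noise_cov q f =
    \int[γ n.+1]_s \int[γ n.+1]_u (D s * D (mix q s u)) + noise_cov q fbar.
  rewrite /noise_cov mean -gg addrA; congr (_ - _).
  rewrite -[X in _ = X + _]addr0 -{1}cross -[X in _ = X + _]addr0 -{1}cross'.
  have hDs : bmfun (fun p => D p.1 * D (mix q p.1 p.2)) by bmc hD.
  have hgs : bmfun (fun p => g p.1 * g (mix q p.1 p.2)) by bmc hg.
  have hDg : bmfun (fun p => D p.1 * g (mix q p.1 p.2)).
    by apply: bmM; [bmc hD|bmc hg].
  have hgD : bmfun (fun p => g p.1 * D (mix q p.1 p.2)).
    by apply: bmM; [bmc hg|bmc hD].
  rewrite -!EPD; try by [apply: bm_int | apply: bmD; apply: bm_int
    | apply: bmD; first apply: bmD; apply: bm_int].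
  apply: eq_EP => s.
  have h1 := bm_section1 (F := fun s u => D s * D (mix q s u)) hDs s.
  have h2 := bm_section1 (F := fun s u => g s * g (mix q s u)) hgs s.
  have h3 := bm_section1 (F := fun s u => D s * g (mix q s u)) hDg s.
  have h4 := bm_section1 (F := fun s u => g s * D (mix q s u)) hgD s.
  rewrite -!EPD; try by [|apply: bmD|apply: bmD; first apply: bmD].
  by apply: eq_EP => u; rewrite !fE; ring.
have varE : gvar f = \int[γ n.+1]_s (D s ^+ 2) + gvar fbar.
  rewrite /gvar mean -g2 addrA; congr (_ - _).
  have hDg : bmfun (fun s => D s * g s) by exact: bmM.
  rewrite -[X in _ = X + _]addr0 -(mulr0 2) -{1}Dg0 -EPZl// -!EPD; try by bm.
  by apply: eq_EP => s; rewrite fE; ring.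
have infl0 : \int[γ n.+1]_s `|D s| <= influence1 f ord0.
  rewrite /influence1 gaussianS; last by bmc hD.
  rewrite gaussianS; last by bmc hf.
  apply: EP_le; [by bmc hD|by bmc hf|move=> x].
  apply: EP_le; [by bmc hD|by bmc hf|move=> t].
  have h1 : bmfun (fun y => f (tcons y t)) by bmc hf.
  rewrite DE -{1}(EP_cst G (f (tcons x t))) -EPB//; last exact: bm_cst.
  apply: le_trans (EP_norm _ _) _; first by apply: bmB => //; exact: bm_cst.
  rewrite le_eqVlt; apply/orP; left; apply/eqP.
  by apply: eq_EP => y; rewrite upd0_tcons.
have inflS i : influence1 fbar i <= influence1 f (lift ord0 i).
  rewrite /influence1 gaussianS; last by bmc hf.
  rewrite [leRHS]EP_fubini; last by bmc hf.
  apply: EP_le; [by bmc hfbar|by bmc hf|move=> t].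
  rewrite [leRHS]EP_fubini; last by bmc hf.
  apply: EP_le; [by bmc hfbar|by bmc hf|move=> y].
  rewrite -EPB; [|by bmc hf..].
  apply: le_trans (EP_norm _ _) _; first by bmc hf.
  rewrite le_eqVlt; apply/orP; left; apply/eqP.
  by apply: eq_EP => x; rewrite updS_tcons.
rewrite covE varE big_ord_recl.
have := noise_form_le hD lam0; have := IH _ hfbar.
have S1 : (\int[γ n.+1]_s `|D s|) ^+ 2 <= influence1 f ord0 ^+ 2.
  by apply: ler_sqrW; [exact: EP_ge0|exact: infl0].
have S2 : \sum_(i < n) influence1 fbar i ^+ 2 <= \sum_(i < n) influence1 f (lift ord0 i) ^+ 2.
  apply: ler_sum => i _; have F0 : 0 <= influence1 fbar i.
    by apply: EP_ge0 => t; apply: EP_ge0.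
  by apply: ler_sqrW; [exact: F0|exact: inflS].
have l3 : 0 <= lam ^+ 3 / 4 by rewrite divr_ge0// exprn_ge0// ltW.
have := ler_wpM2l l3 (lerD S1 S2).
move: (lam ^+ 3 / 4) (3 / (4 * lam)) (\int[γ n.+1]_s \int[γ n.+1]_u _)
  (noise_cov q fbar) (\int[γ n.+1]_t (D t ^+ 2)) (gvar fbar) => c1 c2 X1 X2 Y1 Y2.
move: (_ ^+ 2) (_ ^+ 2) (\sum_(i < n) _) (\sum_(i < n) _) => A B S S'.
clear; rewrite !mulrDr; lra.
Qed.
End martingale.

(** * From one small correlation to all correlations *)

Section dyadic.
Context {R : realType}.
Local Notation borelR := (measurableTypeR R).
Local Notation G := (normal_prob (0 : R) 1).
Local Notation "'γ' n" := (gaussian R n) (at level 10, n at level 9).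

Variables (n : nat) (f : n.-tuple borelR -> R).
Hypotheses (hf : bmfun f) (f1 : forall t, `|f t| <= 1).

Let m := \int[γ n]_t f t.
Let fc t := f t - m.
Let hfc : bmfun fc. Proof. by rewrite /fc; bmc hf. Qed.
Let fc0 : \int[γ n]_t fc t = 0.
Proof. by rewrite /fc EPB ?EP_cst ?subrr//; bmc hf. Qed.

Let fE t : f t = fc t + m. Proof. by rewrite /fc subrK. Qed.

Section fixed_noise.
Variable q : R.
Hypotheses (q0 : 0 <= q) (q1 : q < 1).

Let P t := \int[γ n]_z fc (mix q t z).
Let hP : bmfun P. Proof. by rewrite /P; bmc hfc. Qed.

Lemma noise_covE : noise_cov q f = \int[γ n]_t (fc t * P t).
Proof.
have P0 : \int[γ n]_t P t = 0 by rewrite /P mix_invariant.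
rewrite /noise_cov -/m [X in X - _](_ : _ =
  \int[γ n]_t (fc t * P t + m * fc t + (m * P t + m ^+ 2))).
  rewrite !EPD ?EPZl ?EP_cst ?fc0 ?P0 ?mulr0; try by bm.
  by ring.
apply: eq_EP => t; rewrite fE EPZl; last by bmc hf.
rewrite (@eq_EP _ _ _ _ _ (fun z => fc (mix q t z) + m)); last by move=> z; rewrite fE.
rewrite EPD ?EP_cst -/(P t); [by ring|by bmc hfc|exact: bm_cst].
Qed.

(** P_q is self-adjoint and P_q P_q = P_(q^2). *)
Lemma noise_cov_sqrE : noise_cov (q ^+ 2) f = \int[γ n]_t (P t ^+ 2).
Proof.
have q2 : q ^+ 2 < 1 by rewrite expr_lt1.
have hF : bmfun (fun p => P p.1 * fc p.2) by apply: bmM; [bmc hP|bmc hfc].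
transitivity (\int[γ n]_t \int[γ n]_z (P t * fc (mix q t z))); last first.
  by apply: eq_EP => t; rewrite EPZl ?expr2//; bmc hfc.
rewrite (mix_sym q0 q1 (F := fun t u => P t * fc u))// -/m.
have mix2 t : \int[γ n]_z P (mix q t z) = \int[γ n]_z fc (mix (q ^+ 2) t z).
  exact: mix_mix.
have inv : \int[γ n]_t \int[γ n]_z fc (mix (q ^+ 2) t z) = 0.
  by rewrite mix_invariant// sqr_ge0.
transitivity (\int[γ n]_t (fc t * \int[γ n]_z fc (mix (q ^+ 2) t z))); last first.
  by apply: eq_EP => t; rewrite EPZr -?mix2 1?mulrC//; bmc hP.
rewrite /noise_cov -/m [X in X - _](_ : _ =
  \int[γ n]_t (fc t * \int[γ n]_z fc (mix (q ^+ 2) t z)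
    + m * fc t + (m * \int[γ n]_z fc (mix (q ^+ 2) t z) + m ^+ 2))).
  have hP2 : bmfun (fun t => \int[γ n]_z fc (mix (q ^+ 2) t z)) by bmc hfc.
  rewrite !EPD ?EPZl ?EP_cst ?fc0 ?inv ?mulr0; try by bm.
  by ring.
apply: eq_EP => t; rewrite fE EPZl; last by bmc hf.
rewrite (@eq_EP _ _ _ _ _ (fun z => fc (mix (q ^+ 2) t z) + m)); last first.
  by move=> z; rewrite fE.
by rewrite EPD ?EP_cst; [ring|bmc hfc|exact: bm_cst].
Qed.

Lemma noise_cov_sqr_ge0 : 0 <= noise_cov (q ^+ 2) f.
Proof. by rewrite noise_cov_sqrE; apply: EP_ge0 => t; exact: sqr_ge0. Qed.

(** Cauchy-Schwarz between [f - E f], of norm at most one, and its image under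
    P_q. This is the dyadic form of the log-convexity of the noise covariance
    along the semigroup: it carries a bound at one small correlation to
    every correlation. *)
Lemma noise_cov_sqr_le : noise_cov q f ^+ 2 <= noise_cov (q ^+ 2) f.
Proof.
have v1 : \int[γ n]_t (fc t ^+ 2) <= 1.
  apply: (@le_trans _ _ (\int[γ n]_t (f t ^+ 2))).
    rewrite (@eq_EP _ _ _ _ (fun t => f t ^+ 2)
      (fun t => fc t ^+ 2 + (2 * m * fc t + m ^+ 2))).
      by rewrite !EPD ?EPZl ?EP_cst ?fc0 ?mulr0 ?add0r ?lerDl ?sqr_ge0//; bm.
    by move=> t; rewrite fE; ring.
  rewrite -[leRHS](EP_cst (γ n)); apply: EP_le; [by bmc hf|exact: bm_cst|move=> t].
  by rewrite -real_normK ?num_real// expr_le1.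
rewrite noise_covE noise_cov_sqrE.
apply: le_trans (cauchy_schwarz _ hfc hP) _.
by rewrite ler_piMl//; apply: EP_ge0 => t; exact: sqr_ge0.
Qed.

End fixed_noise.

(** [q] is the square of the correlation [sqrt q]. *)
Lemma noise_cov_ge0 q : 0 <= q -> q < 1 -> 0 <= noise_cov q f.
Proof.
move=> q0 q1; rewrite -(sqr_sqrtr q0); apply: noise_cov_sqr_ge0; rewrite ?sqrtr_ge0//.
by rewrite -sqrtr1 ltr_sqrt.
Qed.

Lemma noise_cov_le1 q : noise_cov q f <= 1.
Proof.
rewrite /noise_cov lerBlDr (@le_trans _ _ 1)//; last by rewrite lerDl sqr_ge0.
rewrite -[leRHS](EP_cst (γ n)); apply: EP_le; [by bmc hf|exact: bm_cst|move=> t].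
rewrite -[leRHS](EP_cst (γ n)); apply: EP_le; [by bmc hf|exact: bm_cst|move=> z].
by rewrite (le_trans (ler_norm _))// normrM mulr_ile1.
Qed.

Lemma noise_cov_dyadic q k : 0 <= q -> q < 1 ->
  noise_cov q f ^+ (2 ^ k) <= noise_cov (q ^+ (2 ^ k)) f.
Proof.
move=> q0 q1; elim: k => [|k IH]; first by rewrite expn0 !expr1.
have p0 : 0 <= q ^+ (2 ^ k) by exact: exprn_ge0.
have p1 : q ^+ (2 ^ k) < 1 by rewrite exprn_ilt1// -lt0n expn_gt0.
rewrite expnSr !exprM; apply: le_trans (noise_cov_sqr_le p0 p1).
apply: ler_sqrW; last exact: IH.
by apply: exprn_ge0; exact: noise_cov_ge0.
Qed.

(** The choice [lam = 1 / noise_cov q f] in [noise_cov_le], together with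
    [gvar f <= 1]. *)
Lemma noise_cov_small q : 0 <= q -> q <= 10^-1 ->
  noise_cov q f ^+ 4 <= \sum_(i < n) influence1 f i ^+ 2.
Proof.
move=> q0 q10; have q1 : q < 1 by apply: le_lt_trans q10 _; rewrite invf_lt1// ltr1n.
have := noise_cov_ge0 q0 q1; rewrite le_eqVlt => /predU1P[<-|v0].
  by rewrite expr0n; apply: sumr_ge0 => i _; exact: sqr_ge0.
have l0 : 0 < (noise_cov q f)^-1 by rewrite invr_gt0.
have := noise_cov_le q0 q10 hf l0.
have g1 : gvar f <= 1.
  rewrite /gvar lerBlDr (@le_trans _ _ 1)//; last by rewrite lerDl sqr_ge0.
  rewrite -[leRHS](EP_cst (γ n)); apply: EP_le; [by bmc hf|exact: bm_cst|move=> t].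
  by rewrite -real_normK ?num_real// expr_le1.
move: (noise_cov q f) (gvar f) (\sum_(i < n) _) v0 l0 g1 => v g S v0 l0 g1 H.
have H1 : 3 / (4 * v^-1) * g <= 3 * v / 4.
  rewrite (_ : 3 / (4 * v^-1) = 3 * v / 4); last by field; rewrite gt_eqF.
  by rewrite ler_piMr// divr_ge0// mulr_ge0// ltW.
have H2 : v <= v ^- 3 * S.
  have : v <= v^-1 ^+ 3 / 4 * S + 3 * v / 4 by apply: (le_trans H); rewrite lerD2l.
  by rewrite exprVn; set c := v ^- 3; nra.
rewrite -(ler_pM2l (_ : 0 < v ^- 3)) ?invr_gt0 ?exprn_gt0//.
by apply: le_trans H2; rewrite le_eqVlt; apply/orP; left; apply/eqP; field; rewrite gt_eqF.
Qed.

(** Since [(1 - x) (1 + x) <= 1], Bernoulli's inequality for [(1 + x)^j]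
    bounds [(1 - x)^j]. *)
Lemma exp_decay (x : R) j : 0 <= x -> x <= 1 -> (1 - x) ^+ j * (1 + j%:R * x) <= 1.
Proof.
move=> x0 x1; elim: j => [|j IH]; first by rewrite expr0 mul0r addr0 mulr1.
apply: le_trans IH; rewrite exprSr -mulrA ler_wpM2l ?exprn_ge0 ?subr_ge0//.
rewrite -natr1; have : 0 <= j%:R :> R by [].
by move: (j%:R) => J J0; nra.
Qed.

(** [N] is the first power of two with [18 <= N rho^2]. Then
    [sqrt (1 - rho^2) ^ N = (1 - rho^2) ^ (N / 2) <= 1 / (1 + 9)], which is a
    correlation that [noise_cov_small] covers, and minimality gives
    [N rho^2 <= 36]. *)
Lemma noise_cov_pow (rho : R) : 0 < rho -> rho < 1 ->
  exists N : nat, [/\ (0 < N)%N, N%:R * rho ^+ 2 <= 36 &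
    noise_cov (Num.sqrt (1 - rho ^+ 2)) f ^+ (4 * N) <=
    \sum_(i < n) influence1 f i ^+ 2].
Proof.
move=> rho0 rho1.
have x0 : 0 < rho ^+ 2 by rewrite exprn_gt0.
have x1 : rho ^+ 2 < 1 by rewrite expr_lt1// ltW.
set r := Num.sqrt _.
have r0 : 0 <= r by exact: sqrtr_ge0.
have r1 : r < 1 by rewrite -sqrtr1 ltr_sqrt//; lra.
have r2 : r ^+ 2 = 1 - rho ^+ 2 by rewrite sqr_sqrtr// subr_ge0 ltW.
have ex : exists k, 18 <= (2 ^ k)%:R * rho ^+ 2.
  exists (Num.bound (18 / rho ^+ 2)).
  rewrite -ler_pdivrMr//; apply: ltW; apply: (@lt_trans _ _ (Num.bound (18 / rho ^+ 2))%:R).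
    by apply: le_lt_trans (archi_boundP _); rewrite ?divr_ge0// ltW.
  by rewrite ltr_nat ltn_expl.
have [k hk kmin] := ex_minnP ex.
case: k hk kmin => [|k] hk kmin; first by rewrite expn0 mul1r in hk; lra.
exists (2 ^ k.+1)%N; split; first by rewrite expn_gt0.
  have : ~~ (18 <= (2 ^ k)%:R * rho ^+ 2) by apply/negP => /kmin; rewrite ltnn.
  by rewrite -ltNge expnS natrM; lra.
have small : r ^+ (2 ^ k.+1) <= 10^-1.
  rewrite expnS exprM r2.
  have := exp_decay (2 ^ k) (ltW x0) (ltW x1).
  have : 0 <= (1 - rho ^+ 2) ^+ (2 ^ k) by rewrite exprn_ge0// subr_ge0 ltW.
  move: hk; rewrite expnS natrM.
  move: ((1 - rho ^+ 2) ^+ (2 ^ k)%N) => E.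
  by move: ((2 ^ k)%:R) (rho ^+ 2) => M x; nra.
apply: le_trans (noise_cov_small _ small); last exact: exprn_ge0.
have v0 : 0 <= noise_cov r f by exact: noise_cov_ge0.
have w0 : 0 <= noise_cov (r ^+ (2 ^ k.+1)) f.
  apply: noise_cov_ge0; first exact: exprn_ge0.
  by apply: (le_lt_trans small); rewrite invf_lt1// ltr1n.
have := noise_cov_dyadic k.+1 r0 r1.
move: (noise_cov (r ^+ (2 ^ k.+1)) f) w0 => w w0.
move: (noise_cov r f) (2 ^ k.+1)%N v0 => v N v0 vw.
rewrite (mulnC 4%N N) (exprM v N 4).
by apply: lerXn2r => //; rewrite nnegrE exprn_ge0.
Qed.

End dyadic.

(** * Measurability of continuous functions of a tuple *)

Section measurability_vec.
Context {R : realType}.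
Local Notation borelR := (measurableTypeR R).

(** An open set is the countable union of the rational boxes it contains. *)
Lemma open_measurable_vec n (U : set 'rV[R]_n) : open U -> measurable (@vec R n @^-1` U).
Proof.
move=> oU.
pose box (p : {ffun 'I_n -> rat * rat}) : set (n.-tuple borelR) :=
  [set t | forall i, ratr (p i).1 < tnth t i < ratr (p i).2].
pose good p := box p `<=` @vec R n @^-1` U.
rewrite (_ : _ @^-1` _ = \bigcup_p (if `[< good p >] then box p else set0)).
  apply: countable_bigcupT_measurable => // p.
  case: ifPn => // _.
  rewrite (_ : box p = \bigcap_(i in [set: 'I_n])
      (fun t : n.-tuple borelR => tnth t i) @^-1` `]ratr (p i).1, ratr (p i).2[%classic).
    apply: fin_bigcap_measurable => [|i _]; first exact: finite_finset.
    rewrite -[_ @^-1` _]setTI.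
    exact: measurable_tnth.
  apply/seteqP; split=> t /= H i; first by move=> _; rewrite /= in_itv/=; exact: H.
  by have := H i I; rewrite /= in_itv.
apply/seteqP; split=> [t /= Ut|t [p _]]; last first.
  by case: ifPn => // /asboolP gp /gp.
have /nbhs_ballP[e /= e0 eU] : nbhs (vec t) U by exact: open_nbhs_nbhs.
have /choice[p hp] : forall i, exists ab : rat * rat,
    tnth t i - e < ratr ab.1 < tnth t i /\ tnth t i < ratr ab.2 < tnth t i + e.
  move=> i.
  have /rat_in_itvoo[a] : tnth t i - e < tnth t i by rewrite ltrBlDr ltrDl.
  have /rat_in_itvoo[b] : tnth t i < tnth t i + e by rewrite ltrDl.
  by rewrite !inE/= => hb ha; exists (a, b).
exists [ffun i => p i] => //.
have -> : `[< good [ffun i => p i] >].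
  apply/asboolP => s hs; apply: eU; split => // j i.
  rewrite /ball/= !mxE.
  have := hs i; rewrite ffunE; have [/andP[h1 h2] /andP[h3 h4]] := hp i.
  by move=> /andP[h5 h6]; rewrite ltr_norml; apply/andP; split; lra.
by move=> i; rewrite ffunE; have [/andP[_ ->] /andP[->]] := hp i.
Qed.

Lemma measurable_vec_comp n (g : 'rV[R]_n -> R) : continuous g ->
  measurable_fun [set: n.-tuple borelR] (fun t => g (vec t)).
Proof.
move=> cg; move=> mT; apply: (measurability _ (RGenOInfty.measurableE R)) => //.
move=> _ [_ [a ->] <-]; rewrite setTI.
rewrite (_ : _ @^-1` _ = @vec R n @^-1` (g @^-1` `]a, +oo[%classic)) //.
by apply: open_measurable_vec; apply: open_comp => // x _; exact: cg.
Qed.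

End measurability_vec.

(** * The L1 Poincare inequality on the line *)

Section poincare.
Context {R : realType}.
Local Notation leb := (@lebesgue_measure R).
Local Notation borelR := (measurableTypeR R).
Local Notation G := (normal_prob (0 : R) 1).

Variables (h h' : R -> R).
Hypothesis dh : forall x, derivable h x 1.
Hypothesis hE : forall x, derive1 h x = h' x.
Hypothesis ch' : continuous h'.

Let ch : continuous h.
Proof. by move=> x; exact/differentiable_continuous/derivable1_diffP. Qed.

Let mh' : measurable_fun [set: borelR] h'.
Proof. exact: continuous_measurable_fun. Qed.

Let mabs : measurable_fun [set: borelR] (fun t => `|h' t|%:E).
Proof. by apply/measurable_EFinP; exact: measurableT_comp. Qed.

Lemma FTC_abs_le (a b : R) : a <= b ->
  (`|h b - h a|%:E <= \int[leb]_(t in `[a, b]) `|h' t|%:E)%E.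
Proof.
rewrite le_eqVlt => /predU1P[->|ab].
  by rewrite subrr normr0; apply: integral_ge0 => t _; rewrite lee_fin.
have -> : `|h b - h a|%:E = `|\int[leb]_(t in `[a, b]) (h' t)%:E|%E.
  rewrite (@continuous_FTC2 _ h' h)//.
  - exact: continuous_subspaceT.
  - split; first by move=> x _; exact: dh.
      by apply: cvg_at_right_filter; exact: ch.
    by apply: cvg_at_left_filter; exact: ch.
apply: le_abse_integral => //.
by apply/measurable_EFinP; exact: measurable_funTS.
Qed.

(** The condition [t * t <= x * t] says that [t] lies between [0] and [x]
    whatever the sign of [x], and it is the form that [tail_le] exploits. *)
Lemma increment_le (x : R) :
  (`|h x - h 0|%:E <= \int[leb]_t (`|h' t| * (t * t <= x * t)%R%:R)%:E)%E.
Proof.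
have [a [b [ab hab sub]]] : exists a b, [/\ a <= b, `|h x - h 0| = `|h b - h a| &
    forall t, a <= t <= b -> t * t <= x * t].
  have [x0|x0] := leP 0 x; [exists 0, x|exists x, 0]; split => //; rewrite ?ltW//.
  - by move=> t /andP[t0 tx]; rewrite ler_wpM2r.
  - by rewrite distrC.
  - by move=> t /andP[tx t0]; rewrite ler_wnM2r.
rewrite hab; apply: le_trans (FTC_abs_le ab) _.
rewrite integral_mkcond; apply: ge0_le_integral => //.
- by move=> t _; apply: erestrict_ge0 => s _; rewrite lee_fin.
- by apply/(measurable_restrict _ _ _) => //; exact: measurable_funTS.
- apply/measurable_EFinP/measurable_funM; first exact: measurableT_comp.
  apply: (@measurableT_comp _ _ _ _ _ _ (fun b : bool => b%:R : R)) => //.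
  by apply: measurable_fun_ler; apply: measurable_funM.
- move=> t _; rewrite /patch; case: ifPn => [|_]; last first.
    by rewrite lee_fin mulr_ge0.
  by rewrite inE/= in_itv/= => /sub ->; rewrite mulr1.
Qed.

(** If [t * t <= x * t] then [t^2 + (x - t)^2 <= x^2], so the Gaussian density
    at [x] is at most [expR (- t ^+ 2 / 2)] times the density of mean [t]. *)
Lemma tail_le (t : R) :
  (\int[G]_x ((t * t <= x * t)%R%:R)%:E <= ((normal_peak 1)^-1 * normal_pdf 0 1 t)%:E)%E.
Proof.
have p0 : 0 < normal_peak (1 : R) by rewrite normal_peak_gt0// oner_neq0.
rewrite integral_normal_prob; last 2 first.
- apply/measurable_EFinP.
  apply: (@measurableT_comp _ _ _ _ _ _ (fun b : bool => b%:R : R)) => //.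
  by apply: measurable_fun_ler => //; apply: measurable_funM.
- by move=> x; rewrite lee_fin.
apply: (@le_trans _ _ (\int[leb]_x ((expR (- t ^+ 2 / 2))%:E * (normal_pdf t 1 x)%:E))%E).
  apply: ge0_le_integral => //.
  - by move=> x _; rewrite -EFinM lee_fin mulr_ge0// normal_pdf_ge0.
  - apply: emeasurable_funM; last by apply/measurable_EFinP; exact: measurable_normal_pdf.
    apply/measurable_EFinP.
    apply: (@measurableT_comp _ _ _ _ _ _ (fun b : bool => b%:R : R)) => //.
    by apply: measurable_fun_ler => //; apply: measurable_funM.
  - apply: emeasurable_funM => //.
    by apply/measurable_EFinP; exact: measurable_normal_pdf.
  - move=> x _; rewrite -!EFinM lee_fin; case: (lerP (t * t) (x * t)) => [tx|_]; last first.
      by rewrite mul0r mulr_ge0 ?expR_ge0// normal_pdf_ge0.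
    rewrite mul1r !normal_pdfE ?oner_neq0// mulrCA ler_pM2l// /normal_fun -expRD ler_expR.
    by rewrite expr1n subr0 -mulr_natr; lra.
rewrite ge0_integralZl_EFin ?expR_ge0//; last 2 first.
- by move=> x _; rewrite lee_fin normal_pdf_ge0.
- by apply/measurable_EFinP; exact: measurable_normal_pdf.
rewrite integral_normal_pdf mule1 lee_fin normal_pdfE ?oner_neq0//.
by rewrite mulrA mulVf ?gt_eqF// mul1r /normal_fun subr0 expr1n.
Qed.

(** Exchanging the integrals in [increment_le] weights [`|h' t|] by the
    Gaussian tail beyond [t], which [tail_le] compares with the density
    at [t]. *)
Lemma gaussian_poincare_L1_origin :
  (\int[G]_x `|h x - h 0|%:E <= (normal_peak 1)^-1%:E * \int[G]_t `|h' t|%:E)%E.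
Proof.
pose J (p : borelR * borelR) : R := (p.2 * p.2 <= p.1 * p.2)%R%:R.
have mJ : measurable_fun setT J.
  apply: (@measurableT_comp _ _ _ _ _ _ (fun b : bool => b%:R : R)) => //.
  by apply: measurable_fun_ler; apply: measurable_funM.
have m1 : measurable_fun [set: borelR * borelR] (fun p => (`|h' p.2| * J p)%:E).
  apply/measurable_EFinP/measurable_funM => //.
  by apply: measurableT_comp => //; apply: measurableT_comp.
have p1 (p : borelR * borelR) : (0 <= (`|h' p.2| * J p)%:E)%E by rewrite lee_fin mulr_ge0.
apply: (@le_trans _ _ (\int[G]_x \int[leb]_t (`|h' t| * J (x, t))%:E)%E).
  apply: ge0_le_integral => //.
  - apply/measurable_EFinP; apply: measurableT_comp => //.
    by apply: measurable_funB => //; exact: continuous_measurable_fun.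
  - exact: (measurable_fun_fubini_tonelli_F (m2 := leb)
      (fun p : borelR * borelR => (`|h' p.2| * J p)%:E) m1 p1).
  - by move=> x _; exact: increment_le.
rewrite (fubini_tonelli (fun p : borelR * borelR => (`|h' p.2| * J p)%:E))//=.
rewrite [in leRHS]integral_normal_prob//.
have mpdf : measurable_fun [set: borelR] (fun x => (normal_pdf (0 : R) 1 x)%:E).
  by apply/measurable_EFinP; exact: measurable_normal_pdf.
rewrite -ge0_integralZl_EFin ?invr_ge0 ?normal_peak_ge0//; last 2 first.
- by move=> t _; rewrite mule_ge0// lee_fin normal_pdf_ge0.
- exact: emeasurable_funM.
apply: ge0_le_integral => //.
- by move=> t _; apply: integral_ge0 => x _; exact: (p1 (x, t)).
- exact: (measurable_fun_fubini_tonelli_G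
    (fun p : borelR * borelR => (`|h' p.2| * J p)%:E) m1 p1).
- by apply: emeasurable_funM => //; exact: emeasurable_funM.
- move=> t _; under eq_integral do rewrite EFinM.
  rewrite ge0_integralZl_EFin//; last 2 first.
  - by move=> x _; rewrite lee_fin.
  - by apply/measurable_EFinP; apply: (measurableT_comp mJ); exact: pair2_measurable.
  rewrite muleCA; apply: lee_wpmul2l; first by rewrite lee_fin.
  by rewrite -EFinM; exact: tail_le.
Qed.

Lemma gaussian_poincare_L1 : bmfun (h : borelR -> R) ->
  ((\int[G]_x \int[G]_y `|h x - h y|)%:E <=
   (2 * (normal_peak 1)^-1)%:E * \int[G]_t `|h' t|%:E)%E.
Proof.
move=> hh; have hd : bmfun (fun x : borelR => `|h x - h 0|) by bm.
have step : \int[G]_x \int[G]_y `|h x - h y| <= 2 * \int[G]_x `|h x - h 0|.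
  have -> : 2 * \int[G]_x `|h x - h 0| =
      \int[G]_x (`|h x - h 0| + \int[G]_y `|h y - h 0|).
    by rewrite EPD ?EP_cst//; [ring|exact: bm_cst].
  apply: EP_le; [by bmc hh|by apply: bmD => //; exact: bm_cst|move=> x].
  rewrite -[X in X + _](EP_cst G) -EPD//; last exact: bm_cst.
  apply: EP_le; [by bmc hh|by apply: bmD => //; exact: bm_cst|move=> y].
  by rewrite (distrC (h y)); exact: ler_distD.
apply: (@le_trans _ _ (2 * \int[G]_x `|h x - h 0|)%:E); first by rewrite lee_fin.
rewrite (EFinM 2 (\int[G]_x `|h x - h 0|)) EFinM -muleA.
rewrite lee_wpmul2l ?lee_fin// -bm_EFin//.
exact: gaussian_poincare_L1_origin.
Qed.

End poincare.

(** * Influences and partial derivatives *)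

Section resampling.
Context {R : realType}.
Local Notation borelR := (measurableTypeR R).
Local Notation G := (normal_prob (0 : R) 1).
Local Notation "'γ' n" := (gaussian R n) (at level 10, n at level 9).

Lemma ge0_gaussianS n (F : n.+1.-tuple borelR -> \bar R) :
  measurable_fun [set: n.+1.-tuple borelR] F -> (forall t, 0 <= F t)%E ->
  (\int[γ n.+1]_t F t = \int[G]_x \int[γ n]_t F (tcons x t))%E.
Proof.
move=> mF F0; rewrite ge0_integral_distribution//.
have mc : measurable_fun [set: borelR * n.-tuple borelR] (fun p => F (tcons p.1 p.2)).
  by apply: measurableT_comp => //; meas.
by rewrite -(fubini_tonelli1 (fun p => F (tcons p.1 p.2)) mc).
Qed.

(** Resampling one coordinate preserves the Gaussian measure; this isolates a
    coordinate for the inequality on the line. *)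
Lemma ge0_gaussian_resample n (i : 'I_n) (F : n.-tuple borelR -> \bar R) :
  measurable_fun [set: n.-tuple borelR] F -> (forall t, 0 <= F t)%E ->
  (\int[γ n]_t F t = \int[γ n]_t \int[G]_y F (upd i t y))%E.
Proof.
elim: n i F => [[]//|n IH] i F mF F0.
have mint : measurable_fun [set: n.+1.-tuple borelR] (fun t => \int[G]_y F (upd i t y))%E.
  apply: (measurable_fun_fubini_tonelli_F (m2 := G)
    (fun p : n.+1.-tuple borelR * borelR => F (upd i p.1 p.2))) => //.
  by apply: measurableT_comp => //; meas.
rewrite [RHS]ge0_gaussianS//; last by move=> t; apply: integral_ge0.
rewrite (ge0_gaussianS mF F0).
have [j ->|->] := unliftP ord0 i.
  apply: eq_integral => x _; rewrite (IH j)//.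
    by apply: eq_integral => t _; apply: eq_integral => y _; rewrite updS_tcons.
  by apply: measurableT_comp => //; meas.
have mc : measurable_fun [set: borelR * n.-tuple borelR] (fun p => F (tcons p.1 p.2)).
  by apply: measurableT_comp => //; meas.
rewrite (fubini_tonelli (fun p => F (tcons p.1 p.2)) mc)//=.
transitivity (\int[G]_x \int[γ n]_t \int[G]_y F (tcons y t))%E; last first.
  apply: eq_integral => x _; apply: eq_integral => t _; apply: eq_integral => y _.
  by rewrite upd0_tcons.
by rewrite integral_cst//= probability_setT mule1.
Qed.

Lemma upd_upd n (i : 'I_n) (t : n.-tuple borelR) x y : upd i (upd i t x) y = upd i t y.
Proof. by apply: eq_from_tnth => j; rewrite !tnth_mktuple; case: eqP. Qed.

End resampling.

Section gradient.
Context {R : realType}.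
Local Notation borelR := (measurableTypeR R).
Local Notation G := (normal_prob (0 : R) 1).
Local Notation "'γ' n" := (gaussian R n) (at level 10, n at level 9).

Lemma vec_upd n (i : 'I_n) (t : n.-tuple borelR) (y : R) :
  vec (upd i t y) = vec (upd i t 0) + y *: delta_mx 0 i.
Proof.
apply/rowP => j; rewrite !mxE !tnth_mktuple eqxx/=.
by case: (j == i); rewrite ?mulr1 ?add0r ?mulr0 ?addr0.
Qed.

Lemma vec_mix n q (t z : n.-tuple borelR) :
  vec (mix q t z) = q *: vec t + Num.sqrt (1 - q ^+ 2) *: vec z.
Proof. by apply/rowP => j; rewrite !mxE tnth_mktuple. Qed.

Section line.
Variables (n : nat) (f : 'rV[R]_n -> R) (v e : 'rV[R]_n).

Lemma derive1_line (y : R) :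
  derive1 (fun s : R => f (v + s *: e)) y = 'D_e f (v + y *: e).
Proof.
rewrite /derive1 /derive; set g1 := (fun _ => _); set g2 := (fun _ => _).
suff -> : g1 = g2 by [].
by apply/funext => s; rewrite /g1 /g2 /= scalerDl addrCA.
Qed.

Lemma derivable_line (y : R) : differentiable f (v + y *: e) ->
  derivable (fun s : R => f (v + s *: e)) y 1.
Proof.
move=> df; have : derivable f (v + y *: e) e by exact: diff_derivable.
rewrite /derivable; set g1 := (fun _ => _); set g2 := (fun _ => _).
suff -> : g1 = g2 by [].
by apply/funext => s; rewrite /g1 /g2 /= scalerDl addrCA -[s *: 1]/(s * 1) mulr1.
Qed.

End line.

(** By [ge0_gaussian_resample], both sides are averages, over the other
    coordinates, of quantities that depend on [f] along a line in the
    direction [i], and [gaussian_poincare_L1] compares those. *)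
Lemma influence1_le n (f : 'rV[R]_n -> R) (i : 'I_n) :
  continuously_differentiable f -> bmfun (fun t : n.-tuple borelR => f (vec t)) ->
  ((influence1 (fun t : n.-tuple borelR => f (vec t)) i)%:E <=
   (2 * (normal_peak 1)^-1)%:E * gaussian_mean (fun x => `|partial f i x|%R))%E.
Proof.
move=> [df cdf] hf; set F := fun t : n.-tuple borelR => f (vec t).
have mp : measurable_fun [set: n.-tuple borelR] (fun t => `|partial f i (vec t)|%:E).
  by apply/measurable_EFinP; apply: measurableT_comp => //; exact: measurable_vec_comp.
pose H t := \int[G]_y `|F t - F (upd i t y)|.
have hH : bmfun H by rewrite /H; bmc hf.
have H0 t : 0 <= H t by apply: EP_ge0.
rewrite /gaussian_mean unlock.
rewrite [in leRHS](ge0_gaussian_resample i)//.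
have mint : measurable_fun [set: n.-tuple borelR]
    (fun t => \int[G]_y `|partial f i (vec (upd i t y))|%:E)%E.
  apply: (measurable_fun_fubini_tonelli_F (m2 := G)
    (fun p : n.-tuple borelR * borelR => `|partial f i (vec (upd i p.1 p.2))|%:E)) => //.
  by apply: (measurableT_comp mp); meas.
have int0 t : (0 <= \int[G]_y `|partial f i (vec (upd i t y))|%:E)%E.
  by apply: integral_ge0 => y _; rewrite lee_fin.
have c0 : 0 <= 2 * (normal_peak (1 : R))^-1 by rewrite mulr_ge0// invr_ge0 normal_peak_ge0.
rewrite -ge0_integralZl_EFin//.
have -> : (influence1 F i)%:E = (\int[γ n]_t (H t)%:E)%E by rewrite bm_EFin.
rewrite (@ge0_gaussian_resample _ _ i (fun t => (H t)%:E))//; last first.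
  by apply/measurable_EFinP; exact: hH.1.
apply: ge0_le_integral => //.
- by move=> t _; apply: integral_ge0 => y _; rewrite lee_fin.
- apply: (measurable_fun_fubini_tonelli_F (m2 := G)
    (fun p : n.-tuple borelR * borelR => (H (upd i p.1 p.2))%:E)).
    by apply/measurable_EFinP; apply: (measurableT_comp hH.1); meas.
  by move=> p; rewrite lee_fin.
- exact: emeasurable_funM.
- move=> t _; set v := vec (upd i t 0); set e : 'rV[R]_n := delta_mx 0 i.
  pose h (y : R) := f (v + y *: e).
  have hE y : F (upd i t y) = h y by rewrite /F vec_upd.
  have hh : bmfun (h : borelR -> R).
    rewrite (_ : h = fun y => F (upd i t y)); last by apply/funext => y; rewrite hE.
    by apply: (bm_comp hf); meas.
  rewrite bm_EFin; last by apply: (bm_comp hH); meas.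
  have -> : \int[G]_y H (upd i t y) = \int[G]_x \int[G]_y `|h x - h y|.
    by apply: eq_EP => x; apply: eq_EP => y; rewrite upd_upd !hE.
  rewrite [X in (_ <= _ * X)%E](_ : _ =
    \int[G]_y `|partial f i (v + y *: e)|%:E)%E; last first.
    by apply: eq_integral => y _; rewrite vec_upd.
  apply: (@gaussian_poincare_L1 _ h (fun y => partial f i (v + y *: e))) => //.
  + by move=> y; exact: derivable_line.
  + by move=> y; exact: derive1_line.
  + move=> y; apply: (@continuous_comp _ _ _ (fun y : R => v + y *: e)); last exact: cdf.
    by apply: cvgD; [exact: cvg_cst|exact: scalel_continuous].
Qed.

End gradient.

(** * The main inequality *)
Section final_arithmetic.
Context {R : realType}.

(** Taking roots of order [4 N]. If [1 <= W], the bound [v <= 1] is enough.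
    Otherwise lowering the exponent of [W] from [1 / (4 N)] to [rho^2 / 144],
    where [144 = 4 * 36], can only increase the power. *)
Lemma root_bound (v W c rho : R) (N : nat) :
  0 <= v -> v <= 1 -> 0 <= W -> 0 <= c -> 0 < rho -> (0 < N)%N ->
  N%:R * rho ^+ 2 <= 36 -> v ^+ (4 * N) <= c ^+ 2 * W ->
  v <= (1 + c) * W `^ (144^-1 * rho ^+ 2).
Proof.
move=> v0 v1 W0 c0 rho0 N0 Nrho vW.
have s0 : 0 < 144^-1 * rho ^+ 2 by rewrite mulr_gt0// exprn_gt0.
have [W00|Wn0] := eqVneq W 0.
  rewrite W00 mulr0 in vW.
  have : v ^+ (4 * N) == 0 by rewrite eq_le vW exprn_ge0.
  by rewrite expf_eq0 => /andP[_ /eqP ->]; rewrite mulr_ge0 ?powR_ge0// addr_ge0.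
have Wgt0 : 0 < W by rewrite lt_neqAle eq_sym Wn0.
have [W1|W1] := leP 1 W.
  apply: (le_trans v1); rewrite -[leLHS]mulr1 ler_pM ?lerDl//.
  by have := ler_powR W1 (ltW s0); rewrite powRr0.
pose s : R := (4 * N%:R)^-1.
have N0' : 0 < N%:R :> R by rewrite ltr0n.
have sgt0 : 0 < s by rewrite invr_gt0 mulr_gt0.
have sN : (4 * N)%:R * s = 1 by rewrite natrM divff// gt_eqF// mulr_gt0.
have vE : v = (v ^+ (4 * N)) `^ s.
  by rewrite -powR_mulrn// -powRrM sN powRr1.
rewrite {1}vE; apply: (@le_trans _ _ ((c ^+ 2 * W) `^ s)).
  by rewrite ge0_ler_powR ?nnegrE ?exprn_ge0 ?mulr_ge0 ?sqr_ge0// ltW.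
rewrite powRM ?sqr_ge0//; apply: ler_pM; rewrite ?powR_ge0//.
- rewrite -powR_mulrn// -powRrM; apply: (@le_trans _ _ ((1 + c) `^ (2%:R * s))).
    apply: ge0_ler_powR; rewrite ?nnegrE//; [|by rewrite addr_ge0|by rewrite lerDr].
    by rewrite mulr_ge0// ltW.
  rewrite -[leRHS]powRr1 ?addr_ge0// ler_powR ?lerDl//.
  have N1 : 1 <= N%:R :> R by rewrite ler1n.
  by rewrite /s ler_pdivrMr ?mul1r ?mulr_gt0//; lra.
- apply: ger_powR; first by rewrite Wgt0 ltW.
  by rewrite /s -[leRHS]div1r ler_pdivlMr ?mulr_gt0//; lra.
Qed.

End final_arithmetic.

Theorem theorem2p2 (R : realType) :
  exists C1 C2 : R, [/\ 0 < C1, 0 < C2 &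
    forall (n : nat) (f : 'rV[R]_n -> R) (rho : R),
      (1 <= n)%N ->
      continuously_differentiable f ->
      (forall x, -1 <= f x <= 1) ->
      0 < rho < 1 ->
      (VAR_gauss f rho <=
       C1%:E *
       (\sum_(i < n) gaussian_mean (fun x => `|partial f i x|%R) ^+ 2)
         `^ (C2 * rho ^+ 2))%E].
Proof.
set c : R := 2 * (normal_peak 1)^-1.
have c0 : 0 <= c by rewrite mulr_ge0// invr_ge0 normal_peak_ge0.
exists (1 + c), (144^-1); split => //; first by rewrite ltr_pwDl.
move=> n f rho _ Cf f1 /andP[rho0 rho1].
have [df cdf] := Cf.
pose F (t : n.-tuple (measurableTypeR R)) := f (vec t).
have F1 t : `|F t| <= 1 by rewrite ler_norml; exact: f1.
have hF : bmfun F.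
  split; last by exists 1.
  by apply: measurable_vec_comp => x; exact: differentiable_continuous.
set r := Num.sqrt (1 - rho ^+ 2).
have rho21 : rho ^+ 2 <= 1 by rewrite expr_le1// ltW.
have r2 : Num.sqrt (1 - r ^+ 2) = rho.
  by rewrite sqr_sqrtr ?subr_ge0// subKr sqrtr_sqr gtr0_norm.
have VE : VAR_gauss f rho = (noise_cov r F)%:E.
  have meanE : gaussian_mean f = (\int[gaussian R n]_t F t)%:E.
    by rewrite /gaussian_mean unlock bm_EFin.
  have hFF : bmfun (fun p => F p.1 * F (mix r p.1 p.2)) by bmc hF.
  have ZE : Z_gauss f rho =
      (\int[gaussian R n]_t \int[gaussian R n]_z (F t * F (mix r t z)))%:E.
    rewrite -(EP_pair (F := fun t z => F t * F (mix r t z)) hFF).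
    rewrite -(bm_EFin _ hFF) /Z_gauss unlock; apply: eq_integral => p _.
    by rewrite /F vec_mix r2.
  by rewrite /VAR_gauss meanE ZE -EFin_expe -EFinB.
rewrite VE.
pose E i := gaussian_mean (fun x => `|partial f i x|).
have E0 i : (0 <= E i)%E.
  by rewrite /E /gaussian_mean unlock; apply: integral_ge0 => t _; rewrite lee_fin.
(* An infinite mean makes the right-hand side infinite. *)
have [fin|] := pselect (forall i, E i \is a fin_num); last first.
  move=> /existsNP[i /negP Ei].
  have Ey : E i = +oo%E by move: Ei (E0 i); case: (E i).
  rewrite (_ : (\sum_(i < n) _)%E = +oo%E); last first.
    have Ey2 : (E i ^+ 2 = +oo)%E by rewrite Ey; exact: mulyy.
    transitivity (E i ^+ 2 + \sum_(j < n | j != i) E j ^+ 2)%E; first exact: bigD1.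
    rewrite Ey2 addye// -ltNye.
    apply: (@lt_le_trans _ _ 0%E); first exact: ltNyr.
    by apply: sume_ge0 => j _; apply: mule_ge0; exact: E0.
  rewrite poweRyr; last by rewrite mulf_neq0// expf_neq0// gt_eqF.
  by rewrite gt0_muley ?leey// lte_fin ltr_pwDl.
pose e i := fine (E i).
have eE i : E i = (e i)%:E by rewrite fineK.
have e0 i : 0 <= e i by rewrite fine_ge0.
rewrite (_ : (\sum_(i < n) _)%E = (\sum_(i < n) e i ^+ 2)%:E); last first.
  by rewrite -sumEFin; apply: eq_bigr => i _; rewrite -/(E i) eE EFin_expe.
rewrite poweR_EFin -EFinM lee_fin.
have r0 : 0 <= r by exact: sqrtr_ge0.
have r1 : r < 1 by rewrite -sqrtr1 ltr_sqrt// ltrBlDr ltrDl exprn_gt0.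
have [N [N0 Nrho vN]] := noise_cov_pow hF F1 rho0 rho1.
apply: (root_bound _ _ _ c0 rho0 N0 Nrho).
- exact: noise_cov_ge0.
- exact: noise_cov_le1.
- by apply: sumr_ge0 => i _; exact: sqr_ge0.
apply: (le_trans vN); rewrite mulr_sumr; apply: ler_sum => i _.
rewrite -exprMn; apply: ler_sqrW; first by apply: EP_ge0 => t; exact: EP_ge0.
by rewrite -lee_fin EFinM -eE; exact: influence1_le.
Qed.
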